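(* Let $J$ be the Jacobi operator with Jacobi parameters $a_n=\sqrt{\lambda_n\mu_{n+1}}$, $b_n=\lambda_n+\mu_n$, $n\in\mathbb{N}_0$. If $$\sum_{n=0}^{\infty}\pi_n(1+\mathfrak{s}_n)^2=\infty,$$ then $J$ is a positive-semidefinite self-adjoint operator and $0$ is not an eigenvalue of $J$. Moreover, if $\mathfrak{s}_\infty<\infty$ then $$\operatorname{Tr}(J^{-1})=\frac{1}{1+\mathfrak{s}_\infty}\sum_{n=0}^{\infty}\pi_n(1+\mathfrak{s}_n)\sum_{j=n}^{\infty}\frac{1}{\lambda_j\pi_j}=\frac{1}{1+\mathfrak{s}_\infty}\sum_{j=0}^{\infty}\frac{1}{\lambda_j\pi_j}\sum_{n=0}^{j}\pi_n(1+\mathfrak{s}_n),$$ and if $\mathfrak{s}_\infty=\infty$ then $$\operatorname{Tr}(J^{-1})=\frac{1}{\mu_0}\sum_{n=0}^{\infty}\pi_n(1+\mathfrak{s}_n).$$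
   Context: $\mathbb{N}_0=\{0,1,2,\dots\}$. Let $(\lambda_n)_{n\ge0}$ and $(\mu_n)_{n\ge0}$ be real sequences with $\lambda_n>0$, $\mu_{n+1}>0$ for all $n\ge0$ and $\mu_0\ge0$. Put $\pi_0=1$ and $\pi_n=\dfrac{\lambda_0\lambda_1\cdots\lambda_{n-1}}{\mu_1\mu_2\cdots\mu_n}$ for $n\ge1$, $\mathfrak{s}_n=\mu_0\sum_{k=0}^{n-1}\dfrac{1}{\lambda_k\pi_k}$, and $\mathfrak{s}_\infty=\lim_{n\to\infty}\mathfrak{s}_n\in[0,\infty]$. The Jacobi operator $J$ with parameters $(a_n),(b_n)$ is the closure in $\ell^2(\mathbb{N}_0)$ of the action on finitely supported sequences of the infinite symmetric tridiagonal matrix with diagonal entries $b_n$ and off-diagonal entries $a_n$. Convention: the (possibly unbounded) operator $J^{-1}$ is self-adjoint and positive, and $\operatorname{Tr}(J^{-1})$ is understood as an element of $[0,\infty]$, with the value $+\infty$ exactly when $J^{-1}$ is not a trace class operator. *)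

(* Defs.v *)
From HB Require Import structures.
From mathcomp Require Import all_boot all_order all_algebra.
From mathcomp Require Export all_classical all_reals all_analysis.
From mathcomp Require Export complex.

Set Implicit Arguments.
Unset Strict Implicit.
Unset Printing Implicit Defensive.

Import Order.TTheory GRing.Theory Num.Theory.
Import numFieldNormedType.Exports.

Local Open Scope classical_set_scope.
Local Open Scope ring_scope.
Local Open Scope complex_scope.

Section HilbertSpace.
Variable R : realType.
Local Notation vec := (nat -> R[i]).

Definition ell2_normsq (x : vec) : \bar R :=
  (\sum_(n <oo) (Normc.normc (x n) ^+ 2)%:E)%E.

Definition ell2 : set vec := [set x | (ell2_normsq x < +oo)%E].

Definition ell2_norm (x : vec) : R := Num.sqrt (fine (ell2_normsq x)).

(* Linear in x, conjugate-linear in y; the complex series is summed on real and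
   imaginary parts. *)
Definition inner (x y : vec) : R[i] :=
  Complex (limn (series (fun n => complex.Re (x n * (y n)^*))))
          (limn (series (fun n => complex.Im (x n * (y n)^*)))).

Definition basis_vec (n : nat) : vec := fun m => (m == n)%:R.

(* A possibly unbounded operator in ell2 is represented by its graph:
   A (x, y) means that x is in the domain of A and A x = y. *)
Definition graph := set (vec * vec).

Definition is_operator (A : graph) : Prop :=
  [/\ forall x y, A (x, y) -> ell2 x /\ ell2 y,
      A ((fun=> 0), (fun=> 0)),
      forall (c : R[i]) x y x' y', A (x, y) -> A (x', y') ->
        A ((fun n => c * x n + x' n), (fun n => c * y n + y' n)) &
      forall x y y', A (x, y) -> A (x, y') -> y = y'].

Definition op_closure (A : graph) : graph :=
  [set p | [/\ ell2 p.1, ell2 p.2 &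
    forall eps : R, 0 < eps -> exists x y,
      [/\ A (x, y), ell2_norm (fun n => p.1 n - x n) < eps &
          ell2_norm (fun n => p.2 n - y n) < eps]]].

Definition densely_defined (A : graph) : Prop :=
  forall x, ell2 x -> forall eps : R, 0 < eps ->
    exists x' y', A (x', y') /\ ell2_norm (fun n => x n - x' n) < eps.

Definition op_adjoint (A : graph) : graph :=
  [set p | [/\ ell2 p.1, ell2 p.2 &
    forall x y, A (x, y) -> inner y p.1 = inner x p.2]].

Definition self_adjoint (A : graph) : Prop :=
  [/\ is_operator A, densely_defined A & op_adjoint A = A].

(* In R[i], 0 <= z means that z is real and nonnegative. *)
Definition positive_semidefinite (A : graph) : Prop :=
  forall x y, A (x, y) -> 0 <= inner y x.

Definition op_eigenvalue (A : graph) (z : R[i]) : Prop :=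
  exists x, x <> (fun=> 0) /\ A (x, (fun n => z * x n)).

Definition op_inv (A : graph) : graph := [set p | A (p.2, p.1)].

Definition op_comp (A B : graph) : graph :=
  [set p | exists y, B (p.1, y) /\ A (y, p.2)].

Definition bounded_operator (A : graph) : Prop :=
  [/\ is_operator A, forall x, ell2 x -> exists y, A (x, y) &
      exists C : R, forall x y, A (x, y) -> ell2_norm y <= C * ell2_norm x].

(* Junk value 0 outside the domain of A. *)
Definition op_apply (A : graph) (x : vec) : vec :=
  xget (fun=> 0) [set y | A (x, y)].

(* The real part only serves to land in \bar R: diag_sum is meant for positive
   semidefinite operators, whose diagonal entries are real and nonnegative. *)
Definition diag_sum (A : graph) : \bar R :=
  (\sum_(n <oo)
     (complex.Re (inner (op_apply A (basis_vec n)) (basis_vec n)))%:E)%E.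

(* P is |A|, the positive square root of A^* A. *)
Definition is_abs_op (A P : graph) : Prop :=
  [/\ self_adjoint P, positive_semidefinite P &
      op_comp P P = op_comp (op_adjoint A) A].

Definition trace_class (A : graph) : Prop :=
  bounded_operator A /\
  exists P, [/\ bounded_operator P, is_abs_op A P & (diag_sum P < +oo)%E].

(* The trace of a positive self-adjoint operator, as an element of [0, +oo]. *)
Definition op_trace (A : graph) : \bar R :=
  if `[< trace_class A >] then diag_sum A else +oo%E.

End HilbertSpace.

Section Jacobi.
Variable R : realType.
Variables a b : nat -> R.

Definition jacobi_entry (m n : nat) : R :=
  if m == n then b n
  else if m == n.+1 then a n
  else if n == m.+1 then a m
  else 0.

(* Row m of the matrix vanishes beyond column m + 1. *)
Definition jacobi_action (x : nat -> R[i]) : nat -> R[i] :=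
  fun m => \sum_(n < m.+2) (jacobi_entry m n)%:C * x n.

Definition finitely_supported (x : nat -> R[i]) : Prop :=
  exists N : nat, forall n, (N <= n)%N -> x n = 0.

Definition jacobi_operator : graph R :=
  op_closure [set p | finitely_supported p.1 /\ p.2 = jacobi_action p.1].

End Jacobi.

Section BirthDeath.
Variable R : realType.
Variables lam mu : nat -> R.

Definition bd_pi (n : nat) : R :=
  (\prod_(k < n) lam k) / (\prod_(k < n) mu k.+1).

Definition bd_s (n : nat) : R :=
  mu 0%N * \sum_(k < n) (lam k * bd_pi k)^-1.

Definition bd_s_infty : \bar R := limn (fun n => (bd_s n)%:E).

Definition bd_jacobi : graph R :=
  jacobi_operator (fun n => Num.sqrt (lam n * mu n.+1))
                  (fun n => lam n + mu n).

End BirthDeath.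

(* Main.v *)
(** Put p_n = (-1)^n sqrt(pi_n) (1 + s_n). Then p solves the formal equation
    J p = 0, and the hypothesis says that p is not square-summable. In the
    unknown t = x / p the operator takes the divergence form
    p_n (J x)_n = c_n (t_n - t_{n+1}) - c_{n-1} (t_{n-1} - t_n), with
    c_n = - a_n p_n p_{n+1} = lam_n pi_n (1 + s_n) (1 + s_{n+1}) > 0.
    - Summing by parts, the maximal operator is nonnegative: a boundary term that
      stayed negative would force t^2 to increase, hence x to dominate p.
    - The formal solution z of (J + 1) z = 0 with z_0 = p_0 satisfies |z| >= |p|, so
      it is not square-summable either. On finitely supported vectors the range
      of J + 1 is the orthogonal of z, hence dense; so the closure J of the minimal
      operator is the maximal one, and J is self-adjoint.
    - The equation J y = e_n gives y_n = p_n^2 (sum_{j >= n} 1 / c_j), so the trace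
      of J^-1 is sum_n p_n^2 sum_{j >= n} 1 / c_j; when this is finite, J^-1 is
      bounded by the Cauchy-Schwarz inequality.
    - Finally sum_{n <= j < m} 1 / c_j is
      (sum_{n <= j < m} 1 / (lam_j pi_j)) / ((1 + s_n) (1 + s_m)). *)

Require Import Defs.
From HB Require Import structures.
From mathcomp Require Import all_boot all_order all_algebra.
From mathcomp Require Import all_classical all_reals all_analysis complex.
From mathcomp Require Import ring lra zify.

Set Implicit Arguments.
Unset Strict Implicit.

Import Order.TTheory GRing.Theory Num.Theory.
Import numFieldNormedType.Exports.

Local Open Scope ring_scope.

(** * Square-summable real sequences *)

Section FiniteSums.
Variable R : realType.
Implicit Types (x y z g w : nat -> R) (C D eps : R).

(** By induction on [s]: the new cross term is absorbed by the arithmetic-geometric mean inequality.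
    Weights are allowed because the bound on the inverse operator uses the weights [(c j)^-1]. *)
Lemma cauchy_schwarz_weighted (I : Type) (s : seq I) (P : pred I)
    (w x y : I -> R) : (forall i, 0 <= w i) ->
  (\sum_(i <- s | P i) w i * x i * y i) ^+ 2 <=
  (\sum_(i <- s | P i) w i * x i ^+ 2) * (\sum_(i <- s | P i) w i * y i ^+ 2).
Proof.
move=> w_ge0; elim: s => [|i s IH]; first by rewrite !big_nil expr0n mulr0.
rewrite !big_cons; case: (P i) => //.
move: IH; set S := \sum_(_ <- _ | _) _; set X := \sum_(_ <- _ | _) _.
set Y := \sum_(_ <- _ | _) _ => IH.
have X0 : 0 <= X by apply: sumr_ge0 => j _; rewrite mulr_ge0 ?sqr_ge0 ?w_ge0.
have Y0 : 0 <= Y by apply: sumr_ge0 => j _; rewrite mulr_ge0 ?sqr_ge0 ?w_ge0.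
have wi := w_ge0 i; set u := x i; set v := y i.
(* Squares are compared: after [S ^+ 2 <= X * Y], the difference of the two sides is a perfect
   square. *)
have cross : 2 * S * (u * v) <= X * v ^+ 2 + u ^+ 2 * Y.
  have rhs0 : 0 <= X * v ^+ 2 + u ^+ 2 * Y.
    by apply: addr_ge0; apply: mulr_ge0 => //; exact: sqr_ge0.
  apply: le_trans (ler_norm _) _.
  rewrite -(ler_pXn2r (n := 2)) ?nnegrE // real_normK ?num_real //.
  apply: (@le_trans _ _ (4 * (X * Y) * (u * v) ^+ 2)).
    have -> : (2 * S * (u * v)) ^+ 2 = 4 * S ^+ 2 * (u * v) ^+ 2 by ring.
    by rewrite ler_wpM2r ?sqr_ge0 // ler_wpM2l.
  rewrite -subr_ge0.
  have -> : (X * v ^+ 2 + u ^+ 2 * Y) ^+ 2 - 4 * (X * Y) * (u * v) ^+ 2 =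
    (X * v ^+ 2 - u ^+ 2 * Y) ^+ 2 by ring.
  exact: sqr_ge0.
have := ler_wpM2l wi cross.
rewrite -subr_ge0 => H1; rewrite -subr_ge0.
have -> : (w i * u ^+ 2 + X) * (w i * v ^+ 2 + Y) - (w i * u * v + S) ^+ 2 =
  (w i * (X * v ^+ 2 + u ^+ 2 * Y) - w i * (2 * S * (u * v))) + (X * Y - S ^+ 2).
  by ring.
by rewrite addr_ge0 // subr_ge0.
Qed.

Lemma cauchy_schwarz x y n :
  (\sum_(k < n) x k * y k) ^+ 2 <=
  (\sum_(k < n) x k ^+ 2) * (\sum_(k < n) y k ^+ 2).
Proof.
have := @cauchy_schwarz_weighted 'I_n (index_enum 'I_n) predT (fun=> 1)
  (fun i => x i) (fun i => y i) (fun=> ler01).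
under eq_bigr do rewrite mul1r.
under [X in _ <= X * _]eq_bigr do rewrite mul1r.
by under [X in _ <= _ * X]eq_bigr do rewrite mul1r.
Qed.

(** Square-summability with an explicit bound, free of limits; [forall C, ~ sqsum_le C x] says that
    [x] is not square-summable. *)
Definition sqsum_le C x := forall n, \sum_(k < n) x k ^+ 2 <= C.

Lemma sqsum_mono x m n : (m <= n)%N ->
  \sum_(k < m) x k ^+ 2 <= \sum_(k < n) x k ^+ 2.
Proof.
elim: n => [|n IH]; first by rewrite leqn0 => /eqP ->.
rewrite leq_eqVlt => /predU1P[->//|]; rewrite ltnS => /IH h.
by rewrite big_ord_recr /= (le_trans h) // lerDl sqr_ge0.
Qed.

Lemma sqsum_ge0 x n : 0 <= \sum_(k < n) x k ^+ 2.
Proof. by apply: sumr_ge0 => i _; exact: sqr_ge0. Qed.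

Lemma sqsum_le_ge0 C x : sqsum_le C x -> 0 <= C.
Proof. by move=> /(_ 0%N); rewrite big_ord0. Qed.

Lemma sqsum_leW C D x : C <= D -> sqsum_le C x -> sqsum_le D x.
Proof. by move=> CD h n; exact: le_trans (h n) CD. Qed.

Lemma sqsum_leD C D x y : sqsum_le C x -> sqsum_le D y ->
  sqsum_le (2 * C + 2 * D) (fun n => x n + y n).
Proof.
move=> hx hy n.
apply: (@le_trans _ _ (\sum_(k < n) (2 * x k ^+ 2 + 2 * y k ^+ 2))).
  apply: ler_sum => k _; rewrite -subr_ge0.
  have -> : 2 * x k ^+ 2 + 2 * y k ^+ 2 - (x k + y k) ^+ 2 = (x k - y k) ^+ 2.
    by ring.
  exact: sqr_ge0.
rewrite big_split /= -!mulr_sumr; apply: lerD.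
  by rewrite ler_pM2l // hx.
by rewrite ler_pM2l // hy.
Qed.

Lemma sqsum_leZ C c x : sqsum_le C x -> sqsum_le (c ^+ 2 * C) (fun n => c * x n).
Proof.
move=> hx n; under eq_bigr do rewrite exprMn.
by rewrite -mulr_sumr ler_wpM2l ?sqr_ge0.
Qed.

Lemma eq_sqsum_le C x y : x =1 y -> sqsum_le C x -> sqsum_le C y.
Proof. by move=> xy h n; under eq_bigr do rewrite -xy; exact: h. Qed.

Lemma sqsum_leB C D x y : sqsum_le C x -> sqsum_le D y ->
  sqsum_le (2 * C + 2 * D) (fun n => x n - y n).
Proof.
move=> hx /(@sqsum_leZ _ (-1)); rewrite sqrrN expr1n mul1r => hy.
by apply: eq_sqsum_le (sqsum_leD hx hy) => n; rewrite mulN1r.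
Qed.

Lemma sqsum_tail C x eps : sqsum_le C x -> 0 < eps ->
  exists M, forall m n, (M <= m)%N ->
    \sum_(k < n) (if (k < m)%N then 0 else x k) ^+ 2 <= eps.
Proof.
move=> hx eps0.
pose A := range (fun n => \sum_(k < n) x k ^+ 2).
have hsA : has_sup A.
  split; first by exists (\sum_(k < 0) x k ^+ 2), 0%N.
  by exists C => _ [n _ <-]; exact: hx.
have [_ [M _ <-] hM] := sup_adherent eps0 hsA.
exists M => m n Mm.
(* Together the two sums form the partial sum of length [maxn m n]. Since the sum up to [M] is
   within [eps] of the supremum, the tail is at most [eps]. *)
have key : \sum_(k < n) (if (k < m)%N then 0 else x k) ^+ 2 + 
    \sum_(k < m) x k ^+ 2 <= sup A.
  apply: (@le_trans _ _ (\sum_(k < maxn m n) x k ^+ 2)); last first.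
    by apply: (sup_upper_bound hsA); exists (maxn m n).
  elim: n => [|n IH]; first by rewrite big_ord0 add0r maxn0.
  rewrite big_ord_recr /=; case: ltnP => nm.
    rewrite expr0n addr0 (le_trans IH) // sqsum_mono //; lia.
  move: IH; have -> : maxn m n = n by lia.
  have -> : maxn m n.+1 = n.+1 by lia.
  rewrite big_ord_recr /=; lra.
have := sqsum_mono x Mm; lra.
Qed.

(* A square-summable sequence is asymptotically orthogonal to a sequence that
   is not square-summable. *)
Lemma sqsum_orthogonal C x z eps : sqsum_le C x ->
  (forall D, ~ sqsum_le D z) -> 0 < eps ->
  exists M, forall n, (M <= n)%N ->
    (\sum_(k < n) x k * z k) ^+ 2 <= eps * \sum_(k < n) z k ^+ 2.
Proof.
move=> hx hz eps0.
have [|m hm] := @sqsum_tail C x (eps / 4) hx; first by lra.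
pose A := \sum_(k < m) x k * z k.
(* The head [A] is a fixed number, so the divergence of the squares of [z] makes it negligible; the
   tail is handled by Cauchy-Schwarz. *)
have [M hM] : exists M, 4 * A ^+ 2 / eps < \sum_(k < M) z k ^+ 2.
  apply: contrapT => /forallNP h; apply: (hz (4 * A ^+ 2 / eps)) => n.
  by rewrite leNgt; apply/negP; exact: h.
exists (maxn m M) => n; rewrite geq_max => /andP[mn Mn].
pose x' k := if (k < m)%N then 0 else x k.
have split_sum : \sum_(k < n) x k * z k = A + \sum_(k < n) x' k * z k.
  elim: n mn {Mn} => [|n IH].
    by rewrite leqn0 /A => /eqP ->; rewrite !big_ord0 addr0.
  rewrite leq_eqVlt => /predU1P[<-|].
    rewrite [X in _ + X]big1 ?addr0 // => k _.
    by rewrite /x' ltn_ord mul0r.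
  rewrite ltnS => mn; rewrite !big_ord_recr /= IH // /x' ltnNge mn /=; ring.
have cs := cauchy_schwarz x' z n.
have tl := hm m n (leqnn m); rewrite -/(x' _) in tl.
set B := \sum_(k < n) x' k * z k in split_sum cs.
set Z := \sum_(k < n) z k ^+ 2 in cs *.
have Z1 : 4 * A ^+ 2 / eps <= Z by rewrite (le_trans (ltW hM)) // sqsum_mono.
have Z2 : 4 * A ^+ 2 <= eps * Z by rewrite [eps * Z]mulrC -ler_pdivrMr.
have B2 : B ^+ 2 <= eps * Z / 4.
  rewrite mulrAC; by apply: le_trans cs _; rewrite ler_wpM2r ?sqsum_ge0.
rewrite split_sum.
have AB : (A + B) ^+ 2 <= 2 * A ^+ 2 + 2 * B ^+ 2.
  by rewrite -subr_ge0 (_ : _ - _ = (A - B) ^+ 2) ?sqr_ge0 //; ring.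
apply: le_trans AB _; clear -Z2 B2.
by move: (A ^+ 2) (B ^+ 2) (eps * Z) Z2 B2 => p q e; lra.
Qed.

End FiniteSums.

(** * Formal tridiagonal equations with a positive solution *)

Section Tridiagonal.
Variable R : realType.
Implicit Types (a b x y z t p f : nat -> R).

Definition tridiag a b x (n : nat) : R :=
  (if n is m.+1 then a m * x m else 0) + b n * x n + a n * x n.+1.

Definition flux_coef a p n : R := - (a n * p n * p n.+1).

Lemma tridiagB a b x y n :
  tridiag a b (fun k => x k - y k) n = tridiag a b x n - tridiag a b y n.
Proof. by rewrite /tridiag; case: n => [|n]; ring. Qed.

Lemma tridiag_shift a b x n :
  tridiag a (fun k => b k + 1) x n = tridiag a b x n + x n.
Proof. by rewrite /tridiag; case: n => [|n]; ring. Qed.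

(** The diagonal terms cancel and the off-diagonal ones telescope, leaving the discrete Wronskian at
    the cut. *)
Lemma green_identity a b x y n :
  \sum_(k < n.+1) (y k * tridiag a b x k - x k * tridiag a b y k) =
  a n * (y n * x n.+1 - y n.+1 * x n).
Proof.
elim: n => [|n IH]; first by rewrite big_ord1 /tridiag /=; ring.
by rewrite big_ord_recr /= IH /tridiag /=; ring.
Qed.

(* The pair [(z n, z n.+1)] for the solution [z] with [z 0 = z0]. *)
Fixpoint trisol a b (z0 : R) n : R * R :=
  if n is m.+1 then
    let u := trisol a b z0 m in (u.2, - (a m * u.1 + b m.+1 * u.2) / a m.+1)
  else (z0, - (b 0%N * z0) / a 0%N).

Lemma tridiag_solution a b (z0 : R) : (forall n, a n != 0) ->
  exists z, z 0%N = z0 /\ forall n, tridiag a b z n = 0.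
Proof.
move=> a0; exists (fun n => (trisol a b z0 n).1); split=> // -[|n].
  by rewrite /tridiag /=; field; exact: a0.
by rewrite /tridiag /=; field; exact: a0.
Qed.

End Tridiagonal.

(** * Energy estimates relative to a solution [p] with positive flux coefficients *)

Section PositiveSolution.
Variable R : realType.
Variables a b p : nat -> R.
Local Notation L := (tridiag a b).
Local Notation c := (flux_coef a p).
Hypothesis c_gt0 : forall n, 0 < c n.
Hypothesis Lp0 : forall n, L p n = 0.
Implicit Types (x y z t f : nat -> R) (C D eps : R).

Lemma sol_neq0 n : p n != 0.
Proof.
apply/eqP => pn; have := c_gt0 n.
by rewrite /flux_coef pn mulr0 mul0r oppr0 ltxx.
Qed.

(** Green's identity against [p], where [L p = 0] removes half of the sum: this is the divergence
    form, summed once. *)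
Lemma flux t n : \sum_(k < n.+1) p k * L (fun k => p k * t k) k =
  c n * (t n - t n.+1).
Proof.
have := green_identity a b (fun k => p k * t k) p n.
under eq_bigr do rewrite Lp0 mulr0 subr0.
by move=> ->; rewrite /flux_coef; ring.
Qed.

(** Converse of [flux]: subtracting consecutive identities isolates [p n * L x n], and [p n] is
    nonzero. An equation [L x = f] is thus solved by choosing the increments of [t]. *)
Lemma flux_solve t f :
  (forall n, c n * (t n - t n.+1) = \sum_(k < n.+1) p k * f k) ->
  forall n, L (fun k => p k * t k) n = f n.
Proof.
move=> h n; apply: (mulfI (sol_neq0 n)).
have := flux t n; rewrite h.
case: n => [|n]; first by rewrite !big_ord1.
have := flux t n; rewrite h => e; rewrite big_ord_recr /= e.
by rewrite [X in _ = X -> _]big_ord_recr /= => /addrI.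
Qed.

(** Summation by parts: a nonnegative Dirichlet form plus a boundary term. *)
Lemma energy_identity t n (x := fun k => p k * t k) :
  \sum_(k < n.+1) x k * L x k =
  \sum_(k < n) c k * (t k.+1 - t k) ^+ 2 + c n * t n * (t n - t n.+1).
Proof.
elim: n => [|n IH].
  have := flux t 0; rewrite !big_ord1 big_ord0 add0r -/x /= => h.
  have -> : x 0%N * L x 0%N = t 0%N * (p 0%N * L x 0%N) by rewrite {1}/x; ring.
  by rewrite h; ring.
have h1 := flux t n; have h2 := flux t n.+1; rewrite -/x in h1 h2.
rewrite big_ord_recr /= h1 in h2.
rewrite big_ord_recr /= IH [in RHS]big_ord_recr /=.
have -> : x n.+1 * L x n.+1 = t n.+1 * (p n.+1 * L x n.+1) by rewrite {1}/x; ring.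
have -> : p n.+1 * L x n.+1 = c n.+1 * (t n.+1 - t n.+2) - c n * (t n - t n.+1).
  by rewrite -h2; ring.
by ring.
Qed.

Hypothesis p_div : forall C, ~ sqsum_le C p.

(** Beyond [M], [p k ^+ 2] is at most [delta^-1 * (p k * t k) ^+ 2], so square-summability would
    pass from [p * t] to [p]. *)
Lemma bounded_away_not_sqsum C t M (delta : R) : 0 < delta ->
  (forall m, (M <= m)%N -> delta <= t m ^+ 2) ->
  ~ sqsum_le C (fun k => p k * t k).
Proof.
move=> d0 ht hC.
apply: (p_div (C := \sum_(k < M) p k ^+ 2 + delta^-1 * C)) => n.
apply: (@le_trans _ _
  (\sum_(k < M) p k ^+ 2 + delta^-1 * \sum_(k < n) (p k * t k) ^+ 2)).
  elim: n => [|n IH].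
    by rewrite !big_ord0 mulr0 addr0 sqsum_ge0.
  case: (ltnP n M) => nM.
    apply: (le_trans (sqsum_mono _ nM)); rewrite lerDl mulr_ge0 //.
      by rewrite invr_ge0 ltW.
    exact: (sqsum_ge0 (fun k => p k * t k)).
  rewrite big_ord_recr /= [X in _ <= _ + _ * X]big_ord_recr /= mulrDr addrA.
  apply: lerD IH _; rewrite mulrC ler_pdivlMr // exprMn.
  by rewrite ler_wpM2l ?sqr_ge0 ?ht.
by rewrite lerD2l ler_pM2l ?invr_gt0.
Qed.

(* If the energy stayed negative, so would the boundary terms
   [c n * t n * (t n - t n.+1)], whence [t n ^+ 2] would eventually increase and
   [x] would dominate a multiple of [p]. *)
Lemma energy_frequently_ge0 C x eps M : sqsum_le C x -> 0 < eps ->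
  exists2 n, (M <= n)%N & - eps <= \sum_(k < n) x k * L x k.
Proof.
move=> hx eps0; apply: contrapT => h.
have {}h n : (M <= n)%N -> \sum_(k < n) x k * L x k < - eps.
  by move=> Mn; rewrite ltNge; apply/negP => hn; apply: h; exists n.
pose t k := x k / p k.
have xE : x = (fun k => p k * t k).
  by apply/funext => k; rewrite /t mulrC divfK ?sol_neq0.
have incr n : (M <= n)%N -> t n ^+ 2 < t n.+1 ^+ 2.
  move=> Mn; have := h n.+1 (leq_trans Mn (leqnSn n)).
  rewrite xE energy_identity => h1.
  have h2 : 0 <= \sum_(k < n) c k * (t k.+1 - t k) ^+ 2.
    by apply: sumr_ge0 => i _; rewrite mulr_ge0 ?sqr_ge0 // ltW.
  have h3 : c n * (t n * (t n - t n.+1)) < 0.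
    by rewrite mulrA; move: (\sum_(k < n) _) (c n * t n * _) h1 h2 => u v; lra.
  rewrite pmulr_rlt0 // in h3; have h4 := sqr_ge0 (t n - t n.+1).
  (* Both contributions favour growth: a square, and minus twice the negative quantity of [h3]. *)
  have e : t n.+1 ^+ 2 - t n ^+ 2 =
    (t n - t n.+1) ^+ 2 - 2 * (t n * (t n - t n.+1)) by ring.
  rewrite -subr_gt0 e.
  by move: (_ ^+ 2) (_ * _) h3 h4 => u v; lra.
have d0 : 0 < t M.+1 ^+ 2 by rewrite (le_lt_trans (sqr_ge0 (t M))) ?incr.
rewrite xE in hx.
apply: (@bounded_away_not_sqsum C t M.+1 _ d0 _ hx) => m Mm.
rewrite -(subnK Mm); elim: (m - M.+1)%N => [//|k IH].
by rewrite addSn (le_trans IH) // ltW // incr //; lia.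
Qed.

(** The resolvent at -1 is a contraction on the maximal domain: expanding [f = L x + x] bounds the
    squares of [x] by those of [f], up to an energy term that is almost nonnegative along
    arbitrarily large cuts. The final bound is [C], independent of [D]. *)
Lemma resolvent_bound C D x f : sqsum_le D x ->
  (forall n, L x n + x n = f n) -> sqsum_le C f -> sqsum_le C x.
Proof.
move=> hx hf hC n; apply/ler_addgt0Pr => eps eps0.
have eps2 : 0 < eps / 2 by rewrite divr_gt0.
have [m nm hm] := energy_frequently_ge0 n hx eps2.
apply: (le_trans (sqsum_mono _ nm)).
have e : \sum_(k < m) x k ^+ 2 + \sum_(k < m) x k * L x k <=
   (\sum_(k < m) x k ^+ 2 + \sum_(k < m) f k ^+ 2) / 2.
  rewrite -!big_split /= mulr_suml; apply: ler_sum => k _.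
  rewrite -hf -subr_ge0.
  by rewrite (_ : _ - _ = (L x k) ^+ 2 / 2) ?divr_ge0 ?sqr_ge0 //; field.
have := hC m.
move: (\sum_(k < m) x k ^+ 2) (\sum_(k < m) x k * L x k)
  (\sum_(k < m) f k ^+ 2) hm e => u v w; lra.
Qed.

(** The flux of a solution vanishes, so [x / p] is constant and [x] is a multiple of [p]. *)
Lemma kernel_trivial C x : (forall n, L x n = 0) -> sqsum_le C x ->
  forall n, x n = 0.
Proof.
move=> Lx hx.
pose t k := x k / p k.
have xE : x = (fun k => p k * t k).
  by apply/funext => k; rewrite /t mulrC divfK ?sol_neq0.
have tc n : t n = t 0%N.
  elim: n => // n IH; rewrite -IH; apply/eqP; rewrite eq_sym -subr_eq0.
  have := flux t n; rewrite -xE; under eq_bigr do rewrite Lx mulr0.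
  by rewrite big1 // => /esym/eqP; rewrite mulf_eq0 gt_eqF //= .
have [t0|t0] := eqVneq (t 0%N) 0.
  by move=> n; rewrite xE tc t0 mulr0.
exfalso; rewrite xE in hx.
apply: (@bounded_away_not_sqsum C t 0 (t 0%N ^+ 2)) hx => [|m _].
  by rewrite exprn_even_gt0.
by rewrite tc.
Qed.

(** With [z 0 = p 0] and [t = z / p], the flux identity gives [c n * (t n.+1 - t n)] as the sum of
    the [p k ^+ 2 * t k], so [t] stays at least 1. Hence [z] has the signs of [p] and dominates it,
    and [flux_solve] becomes available for [L + 1]. *)
Lemma shifted_solution : exists z, [/\
  forall n, tridiag a (fun k => b k + 1) z n = 0,
  forall n, 0 < flux_coef a z n &
  forall C, ~ sqsum_le C z].
Proof.
have a0 n : a n != 0.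
  by apply/eqP => an; have := c_gt0 n; rewrite /flux_coef an !mul0r oppr0 ltxx.
have [z [z0 hz]] := tridiag_solution (fun k => b k + 1) (p 0%N) a0.
pose t k := z k / p k.
have zE : z = (fun k => p k * t k).
  by apply/funext => k; rewrite /t mulrC divfK ?sol_neq0.
(* The bound is carried for all [k <= n] at once, since the flux at [n] involves every earlier
   [t k]. *)
have t1 n : forall k, (k <= n)%N -> 1 <= t k.
  elim: n => [|n IH] k.
    by rewrite leqn0 => /eqP ->; rewrite /t z0 divff ?sol_neq0.
  rewrite leq_eqVlt => /predU1P[->|]; last exact: IH.
  apply: (le_trans (IH n (leqnn n))).
  rewrite -subr_ge0 -(pmulr_rge0 _ (c_gt0 n)) -opprB mulrN -flux -zE.
  rewrite -sumrN; apply: sumr_ge0 => i _; rewrite -mulrN.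
  have -> : - L z i = z i.
    have := hz i; rewrite tridiag_shift => /eqP.
    by rewrite addr_eq0 => /eqP ->; rewrite opprK.
  rewrite {1}zE mulrA -expr2 mulr_ge0 ?sqr_ge0 // (le_trans ler01) //.
  by apply: IH; rewrite -ltnS.
have {}t1 n : 1 <= t n by exact: (t1 n).
exists z; split=> //.
  move=> n; rewrite zE.
  have -> : flux_coef a (fun k => p k * t k) n = c n * (t n * t n.+1).
    by rewrite /flux_coef; ring.
  by rewrite mulr_gt0 // mulr_gt0 // (lt_le_trans ltr01).
move=> C; rewrite zE; apply: (@bounded_away_not_sqsum C t 0 1) => // m _.
by rewrite expr_ge1 // (le_trans ler01).
Qed.

End PositiveSolution.

(** * The minimal operator is dense in the maximal one *)

Section Approximation.
Variable R : realType.
Variables a b p : nat -> R.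
Local Notation L := (tridiag a b).
Hypothesis c_gt0 : forall n, 0 < flux_coef a p n.
Hypothesis Lp0 : forall n, L p n = 0.
Hypothesis p_div : forall C, ~ sqsum_le C p.
Implicit Types (x y z t f : nat -> R) (C D eps : R).

Lemma sum_truncated f n m :
  \sum_(k < m) (if (k < n)%N then f k else 0) = \sum_(k < minn m n) f k.
Proof.
elim: m => [|m IH]; first by rewrite min0n !big_ord0.
rewrite big_ord_recr /= IH; case: ltnP => mn.
  by rewrite (minn_idPl mn) big_ord_recr.
by rewrite addr0 (minn_idPr (leqW mn)).
Qed.

Lemma finsupp_sqsum x N : (forall n, (N <= n)%N -> x n = 0) ->
  sqsum_le (\sum_(k < N) x k ^+ 2) x.
Proof.
move=> hx n; rewrite (eq_bigr (fun k : 'I_n =>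
    if (k < N)%N then x k ^+ 2 else 0)); last first.
  by move=> k _; case: ltnP => // /hx ->; rewrite expr0n.
by rewrite (sum_truncated (fun k => x k ^+ 2)) sqsum_mono // geq_minr.
Qed.

(* The range of [L + 1] on vectors supported in [0, n) consists of the vectors
   supported in [0, n] that are orthogonal to the solution [z] of
   [(L + 1) z = 0]; as [z] is not square-summable, removing the component of
   [(L + 1) x] along the truncation of [z] is a vanishing perturbation. *)
Lemma minimal_dense_in_maximal C D x eps : sqsum_le C x -> sqsum_le D (L x) ->
  0 < eps -> exists x', [/\ exists N, forall n, (N <= n)%N -> x' n = 0,
    sqsum_le eps (fun n => x n - x' n) &
    sqsum_le eps (fun n => L x n - L x' n)].
Proof.
move=> hC hD eps0.
have [z [Lz cz z_div]] := shifted_solution c_gt0 Lp0 p_div.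
pose g k := L x k + x k.
have hg : sqsum_le (2 * D + 2 * C) g by exact: sqsum_leD.
have e4 : eps / 4 <= eps by lra.
have e8 : 0 < eps / 8 by rewrite divr_gt0.
have [M1 hM1] := sqsum_orthogonal hg z_div e8.
have [M2 hM2] := sqsum_tail hg e8.
(* A successor, so that [Z] contains the nonzero term [z 0 ^+ 2]. *)
pose n := (maxn M1 M2).+1.
have M1n : (M1 <= n)%N by rewrite /n; lia.
have M2n : (M2 <= n)%N by rewrite /n; lia.
have {hM1} := hM1 n M1n; set A := \sum_(k < n) _; set Z := \sum_(k < n) _ => hA.
have Z0 : 0 < Z.
  rewrite /Z big_ord_recl /= ltr_pwDl ?sumr_ge0 // => [|i _]; last exact: sqr_ge0.
  by rewrite exprn_even_gt0 //=; exact: sol_neq0 cz 0%N.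
(* The coefficient that makes [y] orthogonal to [z]. *)
pose beta := A / Z.
pose y k := if (k < n)%N then g k - beta * z k else 0.
pose F j := \sum_(k < j.+1) z k * y k.
(* Orthogonality stops the flux from index [n - 1] on; the tail sums [t] of [F j / flux_coef a z j]
   then vanish from [n] on, which gives [x'] finite support. *)
have F0 j : (n <= j.+1)%N -> F j = 0.
  move=> nj; rewrite /F.
  rewrite (eq_bigr (fun k : 'I_j.+1 =>
    if (k < n)%N then g k * z k - beta * z k ^+ 2 else 0)); last first.
    by move=> k _; rewrite /y; case: ifP => _; ring.
  rewrite (sum_truncated (fun k => g k * z k - beta * z k ^+ 2)) (minn_idPr nj).
  by rewrite sumrB -mulr_sumr -/A -/Z /beta divfK ?subrr // gt_eqF.
pose t m := \sum_(m <= j < n) F j / flux_coef a z j.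
have tE m : flux_coef a z m * (t m - t m.+1) = F m.
  have [mn|nm] := ltnP m n; last first.
    by rewrite /t !big_geq ?subrr ?mulr0 ?F0 // leqW.
  by rewrite {1}/t big_ltn // addrK mulrC divfK // gt_eqF.
have Lx' := flux_solve cz Lz tE.
pose x' k := z k * t k; rewrite -/x' in Lx'.
have x'0 k : (n <= k)%N -> x' k = 0.
  by move=> nk; rewrite /x' /t big_geq ?mulr0.
pose r k := g k - y k.
have hd k : L (fun i => x i - x' i) k + (x k - x' k) = r k.
  by rewrite -tridiag_shift tridiagB Lx' tridiag_shift.
(* The residue is [beta * z] below [n] and [g] beyond. The first part costs [A ^+ 2 / Z], the second
   a tail of [g], each at most [eps / 8]. *)
have hr : sqsum_le (eps / 4) r.
  move=> m.
  rewrite (eq_bigr (fun k : 'I_m => (if (k < n)%N then (beta * z k) ^+ 2 else 0)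
     + (if (k < n)%N then 0 else g k) ^+ 2)); last first.
    by move=> k _; rewrite /r /y; case: ifP => _; ring.
  rewrite big_split /= (sum_truncated (fun k => (beta * z k) ^+ 2)).
  have -> : eps / 4 = eps / 8 + eps / 8 by field.
  apply: lerD; last exact: hM2.
  apply: (@le_trans _ _ (beta ^+ 2 * Z)).
    rewrite (le_trans (sqsum_mono (fun k => beta * z k) (geq_minr m n))) //.
    by rewrite /Z mulr_sumr ler_sum // => k _; rewrite exprMn.
  rewrite /beta expr_div_n [Z ^+ 2]expr2 invfM mulrA divfK ?gt_eqF //.
  by rewrite ler_pdivrMr.
have hx' := finsupp_sqsum x'0.
have hxx' : sqsum_le (eps / 4) (fun k => x k - x' k).
  by apply: (resolvent_bound c_gt0 Lp0 p_div (sqsum_leB hC hx') hd hr).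
exists x'; split; first by exists n.
  by exact: sqsum_leW hxx'.
have eq_Ld k : r k - (x k - x' k) = L x k - L x' k.
  by rewrite -hd addrK tridiagB.
(* The two bounds [eps / 4] double under subtraction and add up to [eps]. *)
apply: eq_sqsum_le eq_Ld _; apply: sqsum_leW (sqsum_leB hr hxx').
by rewrite le_eqVlt (_ : _ == _) //; apply/eqP; field.
Qed.

(** Replacing [x] by a finitely supported approximation kills the boundary term of Green's identity,
    and Cauchy-Schwarz controls the error. *)
Lemma maximal_symmetric Cx Dx Cy Dy x y eps :
  sqsum_le Cx x -> sqsum_le Dx (L x) -> sqsum_le Cy y -> sqsum_le Dy (L y) ->
  0 < eps -> exists M, forall n, (M <= n)%N ->
    (\sum_(k < n) (y k * L x k - x k * L y k)) ^+ 2 <= eps.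
Proof.
move=> hx hLx hy hLy eps0.
have Cy0 := sqsum_le_ge0 hy; have Dy0 := sqsum_le_ge0 hLy.
(* The errors amount to [2 * (Cy + Dy) * (eps / K)]; the added 1 keeps [K] positive. *)
pose K := 2 * (Cy + Dy) + 1.
have K0 : 0 < K by rewrite /K; lra.
have d0 : 0 < eps / K by rewrite divr_gt0.
have [x' [[N x'0] hd hLd]] := minimal_dense_in_maximal hx hLx d0.
exists N.+1 => -[//|n]; rewrite ltnS => Nn.
pose u := \sum_(k < n.+1) y k * (L x k - L x' k).
pose v := \sum_(k < n.+1) (x k - x' k) * L y k.
have -> : \sum_(k < n.+1) (y k * L x k - x k * L y k) = u - v.
  have := green_identity a b x' y n.
  rewrite !x'0 //; last exact: leqW.
  rewrite !mulr0 subrr mulr0 => e.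
  apply/eqP; rewrite -subr_eq0 -[X in _ == X]e /u /v -!sumrB.
  by apply/eqP; apply: eq_bigr => k _; ring.
have hu : u ^+ 2 <= Cy * (eps / K).
  apply: le_trans (cauchy_schwarz y (fun k => L x k - L x' k) n.+1) _.
  by apply: ler_pM; rewrite ?(sqsum_ge0 (fun k => L x k - L x' k)) ?sqsum_ge0.
have hv : v ^+ 2 <= (eps / K) * Dy.
  apply: le_trans (cauchy_schwarz (fun k => x k - x' k) (L y) n.+1) _.
  by apply: ler_pM; rewrite ?(sqsum_ge0 (fun k => x k - x' k)) ?sqsum_ge0.
have h : (u - v) ^+ 2 <= 2 * u ^+ 2 + 2 * v ^+ 2.
  by rewrite -subr_ge0 (_ : _ - _ = (u + v) ^+ 2) ?sqr_ge0 //; ring.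
apply: (le_trans h); apply: (@le_trans _ _ (K * (eps / K))).
  rewrite /K [X in _ <= X]mulrDl mul1r.
  move: (eps / K) d0 hu hv => e e0 hu hv; move: (u ^+ 2) (v ^+ 2) hu hv => U V hu hv.
  have -> : 2 * (Cy + Dy) * e = 2 * (Cy * e) + 2 * (e * Dy) by ring.
  move: (Cy * e) (e * Dy) hu hv => s1 s2; lra.
by rewrite mulrC divfK // gt_eqF.
Qed.

End Approximation.

(** * The Hilbert space of the definitions in real coordinates *)

Section ComplexSequences.
Variable R : realType.
Local Open Scope complex_scope.
Local Open Scope classical_set_scope.
Implicit Types (z : nat -> R[i]) (x y u v : nat -> R) (C D eps : R).

Definition re_seq z n : R := complex.Re (z n).
Definition im_seq z n : R := complex.Im (z n).

(** The bridge between extended-real series and uniform bounds on partial sums. *)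
Lemma nneseries_leP (f : nat -> R) m (C : \bar R) : (forall n, 0 <= f n) ->
  (\sum_(m <= n <oo) (f n)%:E <= C)%E <->
  forall n, ((\sum_(m <= k < n) f k)%:E <= C)%E.
Proof.
move=> f0; split=> [h n|h].
  apply: le_trans h; rewrite -sumEFin; apply: nneseries_lim_ge => k _ _.
  by rewrite lee_fin.
apply: lime_le; first by apply: is_cvg_nneseries => n _ _; rewrite lee_fin.
by apply: nearW => n; rewrite sumEFin.
Qed.

Lemma sqr_normcE (c : R[i]) :
  Normc.normc c ^+ 2 = complex.Re c ^+ 2 + complex.Im c ^+ 2.
Proof. by case: c => s t /=; rewrite sqr_sqrtr // addr_ge0 ?sqr_ge0. Qed.

Lemma ell2_normsq_leP z C : (ell2_normsq z <= C%:E)%E <->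
  forall n, \sum_(k < n) re_seq z k ^+ 2 + \sum_(k < n) im_seq z k ^+ 2 <= C.
Proof.
rewrite /ell2_normsq nneseries_leP; last by move=> n; exact: sqr_ge0.
have e n : \sum_(0 <= k < n) Normc.normc (z k) ^+ 2 =
    \sum_(k < n) re_seq z k ^+ 2 + \sum_(k < n) im_seq z k ^+ 2.
  by rewrite big_mkord -big_split /=; apply: eq_bigr => k _; rewrite sqr_normcE.
by split=> h n; have := h n; rewrite lee_fin e.
Qed.

Lemma ell2_normsq_ge0 z : (0 <= ell2_normsq z)%E.
Proof. by apply: nneseries_ge0 => n _ _; rewrite lee_fin sqr_ge0. Qed.

Lemma ell2_normE z : ell2 z -> ell2_normsq z = (ell2_norm z ^+ 2)%:E.
Proof.
rewrite /ell2 /= => hz; rewrite /ell2_norm sqr_sqrtr ?fineK //.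
  by rewrite ge0_fin_numE // ell2_normsq_ge0.
by rewrite fine_ge0 // ell2_normsq_ge0.
Qed.

Lemma ell2P z : ell2 z <->
  exists C, sqsum_le C (re_seq z) /\ sqsum_le C (im_seq z).
Proof.
split=> [/ell2_normE h|[C [hr hi]]].
  have /ell2_normsq_leP {}h : (ell2_normsq z <= (ell2_norm z ^+ 2)%:E)%E by rewrite h.
  exists (ell2_norm z ^+ 2); split=> n; apply: le_trans (h n).
    by rewrite lerDl sqsum_ge0.
  by rewrite lerDr sqsum_ge0.
have /ell2_normsq_leP h : forall n,
    \sum_(k < n) re_seq z k ^+ 2 + \sum_(k < n) im_seq z k ^+ 2 <= C + C.
  by move=> n; rewrite lerD.
by rewrite /ell2 /= (le_lt_trans h) // ltry.
Qed.

Lemma ell2_norm_le z C : 0 <= C ->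
  (forall n, \sum_(k < n) re_seq z k ^+ 2 + \sum_(k < n) im_seq z k ^+ 2 <= C ^+ 2) ->
  ell2_norm z <= C.
Proof.
move=> C0 /ell2_normsq_leP h.
rewrite -(ger0_norm C0) -sqrtr_sqr ler_wsqrtr //.
by rewrite -lee_fin fineK // ge0_fin_numE ?ell2_normsq_ge0 // (le_lt_trans h) ?ltry.
Qed.

Lemma ell2_norm_partial z n : ell2 z ->
  \sum_(k < n) re_seq z k ^+ 2 + \sum_(k < n) im_seq z k ^+ 2 <= ell2_norm z ^+ 2.
Proof. by move=> hz; move: n; apply/ell2_normsq_leP; rewrite ell2_normE. Qed.

Lemma ell2_coord_le z n : ell2 z ->
  `|re_seq z n| <= ell2_norm z /\ `|im_seq z n| <= ell2_norm z.
Proof.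
move=> hz; have := ell2_norm_partial n.+1 hz; rewrite !big_ord_recr /= => h.
have h1 := sqsum_ge0 (re_seq z) n; have h2 := sqsum_ge0 (im_seq z) n.
have h3 := sqr_ge0 (re_seq z n); have h4 := sqr_ge0 (im_seq z n).
have N0 : 0 <= ell2_norm z by exact: sqrtr_ge0.
split; rewrite -(ler_pXn2r (n := 2)) ?nnegrE // real_normK ?num_real //;
  by move: (\sum_(k < n) _) (\sum_(k < n) _) (re_seq z n ^+ 2)
    (im_seq z n ^+ 2) (ell2_norm z ^+ 2) h h1 h2 h3 h4 => u v s t N; lra.
Qed.

Lemma ell2D (c : R[i]) z z' : ell2 z -> ell2 z' -> ell2 (fun n => c * z n + z' n).
Proof.
move=> /ell2P[C [h1 h2]] /ell2P[D [h3 h4]]; apply/ell2P.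
case: c => s t.
exists (2 * (2 * (s ^+ 2 * C) + 2 * (t ^+ 2 * C)) + 2 * D); split.
  apply: eq_sqsum_le (sqsum_leD (sqsum_leB (sqsum_leZ s h1) (sqsum_leZ t h2)) h3).
  by move=> n; rewrite /re_seq /im_seq /=; case: (z n) (z' n) => ? ? [].
apply: eq_sqsum_le (sqsum_leD (sqsum_leD (sqsum_leZ s h2) (sqsum_leZ t h1)) h4).
by move=> n; rewrite /re_seq /im_seq /=; case: (z n) (z' n) => ? ? [].
Qed.

Lemma ell2B z z' : ell2 z -> ell2 z' -> ell2 (fun n => z n - z' n).
Proof.
move=> hz hz'; have := ell2D (-1) hz' hz.
by under eq_fun do rewrite mulN1r addrC.
Qed.

Lemma finitely_supported_ell2 z : finitely_supported z -> ell2 z.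
Proof.
move=> [N hN]; apply/ell2P.
have hr := @finsupp_sqsum _ (re_seq z) N.
have hi := @finsupp_sqsum _ (im_seq z) N.
exists (\sum_(k < N) re_seq z k ^+ 2 + \sum_(k < N) im_seq z k ^+ 2).
split; [apply: sqsum_leW (hr _)|apply: sqsum_leW (hi _)].
- by rewrite lerDl sqsum_ge0.
- by move=> n Nn; rewrite /re_seq hN.
- by rewrite lerDr sqsum_ge0.
- by move=> n Nn; rewrite /im_seq hN.
Qed.

Lemma ell2_0 : ell2 (fun=> 0 : R[i]).
Proof. by apply: finitely_supported_ell2; exists 0%N. Qed.

Lemma ell2_norm0 : ell2_norm (fun=> 0 : R[i]) = 0.
Proof.
apply/eqP; rewrite eq_le sqrtr_ge0 andbT ell2_norm_le // => n.
by rewrite !big1 ?addr0 ?expr0n // => k _; rewrite ?/re_seq ?/im_seq expr0n.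
Qed.

Lemma ell2_truncation z eps : ell2 z -> 0 < eps ->
  exists2 z', finitely_supported z' & ell2_norm (fun n => z n - z' n) < eps.
Proof.
move=> /ell2P[C [hr hi]] eps0.
(* Real and imaginary tails share [(eps / 2) ^+ 2]; the remaining half of [eps] makes the inequality
   strict. *)
have d0 : 0 < (eps / 2) ^+ 2 / 2 by rewrite divr_gt0 // exprn_gt0 // divr_gt0.
have [M1 hM1] := sqsum_tail hr d0; have [M2 hM2] := sqsum_tail hi d0.
pose m := maxn M1 M2.
exists (fun n => if (n < m)%N then z n else 0).
  by exists m => n mn; rewrite ltnNge mn.
apply: (@le_lt_trans _ _ (eps / 2)); last by rewrite ltr_pdivrMr // ltr_pMr // ltr1n.
apply: ell2_norm_le => [|n]; first by rewrite divr_ge0 // ltW.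
have := lerD (hM1 m n (leq_maxl _ _)) (hM2 m n (leq_maxr _ _)).
have -> : (eps / 2) ^+ 2 / 2 + (eps / 2) ^+ 2 / 2 = (eps / 2) ^+ 2 by field.
apply: le_trans; apply: lerD; apply: ler_sum => k _; rewrite ?/re_seq ?/im_seq;
  by case: ifP => _; rewrite ?subrr ?subr0 //=.
Qed.

Definition real_ip x y : R := limn (series (fun n => x n * y n)).

Lemma normM_le_sqrD (s t : R) : `|s * t| <= s ^+ 2 + t ^+ 2.
Proof.
have h1 := sqr_ge0 (s - t); have h2 := sqr_ge0 (s + t).
have h3 := sqr_ge0 s; have h4 := sqr_ge0 t.
rewrite sqrrB in h1; rewrite sqrrD in h2.
by rewrite ler_norml; apply/andP; split; lra.
Qed.

(** The series converges absolutely, since [C + D] bounds the partial sums of the absolute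
    values. *)
Lemma real_ip_is_cvg C D x y : sqsum_le C x -> sqsum_le D y ->
  cvgn (series (fun n => x n * y n)).
Proof.
move=> hx hy; apply: normed_cvg; apply: nondecreasing_is_cvgn.
  apply/nondecreasing_seqP => n; change (\sum_(0 <= k < n) `|x k * y k| <=
    \sum_(0 <= k < n.+1) `|x k * y k|).
  rewrite big_nat_recr //=.
  by rewrite lerDl.
exists (C + D) => _ [n _ <-].
change (\sum_(0 <= k < n) `|x k * y k| <= C + D); rewrite big_mkord.
apply: le_trans (lerD (hx n) (hy n)); rewrite -big_split /=.
by apply: ler_sum => k _; exact: normM_le_sqrD.
Qed.

Lemma real_ipC x y : real_ip x y = real_ip y x.
Proof. by rewrite /real_ip; under eq_fun do rewrite mulrC. Qed.

Lemma real_ip_eventually x y (l : R) N :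
  (forall n, (N <= n)%N -> \sum_(k < n) x k * y k = l) -> real_ip x y = l.
Proof.
move=> h; apply: lim_near_cst => //; exists N => // n /= Nn.
by rewrite seriesEnat /= big_mkord h.
Qed.

Lemma innerE z z' : ell2 z -> ell2 z' -> inner z z' =
  Complex (real_ip (re_seq z) (re_seq z') + real_ip (im_seq z) (im_seq z'))
          (real_ip (im_seq z) (re_seq z') - real_ip (re_seq z) (im_seq z')).
Proof.
move=> /ell2P[C [h1 h2]] /ell2P[D [h3 h4]].
rewrite /inner /real_ip; congr Complex.
  rewrite -limD; [|exact: real_ip_is_cvg h1 h3|exact: real_ip_is_cvg h2 h4].
  apply: (congr1 (fun u : nat -> R => limn u)); apply/funext => n.
  change (\sum_(0 <= k < n) complex.Re (z k * (z' k)^*) =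
    \sum_(0 <= k < n) re_seq z k * re_seq z' k +
    \sum_(0 <= k < n) im_seq z k * im_seq z' k).
  rewrite -big_split /=.
  apply: eq_bigr => k _; rewrite /re_seq /im_seq.
  by case: (z k) (z' k) => s t [s' t'] /=; ring.
rewrite -limB; [|exact: real_ip_is_cvg h2 h3|exact: real_ip_is_cvg h1 h4].
apply: (congr1 (fun u : nat -> R => limn u)); apply/funext => n.
change (\sum_(0 <= k < n) complex.Im (z k * (z' k)^*) =
  \sum_(0 <= k < n) im_seq z k * re_seq z' k -
  \sum_(0 <= k < n) re_seq z k * im_seq z' k).
rewrite -sumrB.
apply: eq_bigr => k _; rewrite /re_seq /im_seq.
by case: (z k) (z' k) => s t [s' t'] /=; ring.
Qed.

End ComplexSequences.

(** * Self-adjointness and positivity *)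

Section JacobiOperator.
Variable R : realType.
Variables a b p : nat -> R.
Local Open Scope complex_scope.
Local Open Scope classical_set_scope.
Local Notation L := (tridiag a b).
Local Notation J := (jacobi_operator a b).
Hypothesis c_gt0 : forall n, 0 < flux_coef a p n.
Hypothesis Lp0 : forall n, L p n = 0.
Hypothesis p_div : forall C, ~ sqsum_le C p.
Implicit Types (z w : nat -> R[i]) (x y : nat -> R) (C D eps : R).

Lemma jacobi_actionE z m : jacobi_action a b z m =
  (if m is k.+1 then (a k)%:C * z k else 0) + (b m)%:C * z m + (a m)%:C * z m.+1.
Proof.
rewrite /jacobi_action !big_ord_recr /= /jacobi_entry !eqxx.
have -> : (m == m.+1) = false by apply/eqP; lia.
have -> : (m == m.+2) = false by apply/eqP; lia.
congr (_ + _ + _); case: m => [|k]; first by rewrite big_ord0.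
rewrite big_ord_recr /= !eqxx.
have -> : (k.+1 == k) = false by apply/eqP; lia.
rewrite big1 ?add0r // => i _; have := ltn_ord i => ik.
have -> : (k.+1 == i :> nat) = false by apply/eqP; lia.
have -> : (k.+1 == i.+1 :> nat) = false by apply/eqP; lia.
have -> : (i == k.+2 :> nat) = false by apply/eqP; lia.
by rewrite mul0r.
Qed.

Lemma re_jacobi z : re_seq (jacobi_action a b z) = L (re_seq z).
Proof.
apply/funext => n; rewrite /re_seq jacobi_actionE /tridiag.
by case: n => [|n]; case: (z _) => ? ?; case: (z _) => ? ? /=;
  try (case: (z _) => ? ? /=); ring.
Qed.

Lemma im_jacobi z : im_seq (jacobi_action a b z) = L (im_seq z).
Proof.
apply/funext => n; rewrite /im_seq jacobi_actionE /tridiag.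
by case: n => [|n]; case: (z _) => ? ?; case: (z _) => ? ? /=;
  try (case: (z _) => ? ? /=); ring.
Qed.

Lemma jacobi_eqP z w : w = jacobi_action a b z <->
  re_seq w = L (re_seq z) /\ im_seq w = L (im_seq z).
Proof.
split=> [->|[hr hi]]; first by rewrite re_jacobi im_jacobi.
apply/funext => n; apply/eqP; rewrite eq_complex; apply/andP; split; apply/eqP.
  by have := congr1 (fun f => f n) hr; rewrite -re_jacobi.
by have := congr1 (fun f => f n) hi; rewrite -im_jacobi.
Qed.

Lemma jacobi_actionD c z w :
  jacobi_action a b (fun n => c * z n + w n) =
  (fun n => c * jacobi_action a b z n + jacobi_action a b w n).
Proof.
apply/funext => n; rewrite /jacobi_action mulr_sumr -big_split /=.
by apply: eq_bigr => k _; rewrite mulrDr mulrCA.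
Qed.

Lemma finitely_supported_jacobi z : finitely_supported z ->
  finitely_supported (jacobi_action a b z).
Proof.
move=> [N hN]; exists N.+1 => -[//|n]; rewrite ltnS => Nn.
by rewrite jacobi_actionE !hN ?mulr0 ?addr0 //; lia.
Qed.

(** Each row of [L] is continuous for coordinatewise convergence; this passes the equation to the
    closure of the graph. *)
Lemma tridiag_le x n eps : (forall k, `|x k| <= eps) ->
  `|L x n| <= (`|if n is m.+1 then a m else 0| + `|b n| + `|a n|) * eps.
Proof.
move=> hx; rewrite /tridiag !mulrDl.
apply: le_trans (ler_normD _ _) _; apply: lerD; last first.
  by rewrite normrM ler_wpM2l.
apply: le_trans (ler_normD _ _) _; apply: lerD; last first.
  by rewrite normrM ler_wpM2l.
by case: n => [|n]; rewrite ?normrM ?normr0 ?mul0r // ler_wpM2l.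
Qed.

Lemma eq_of_close (s t K : R) :
  (forall eps, 0 < eps -> `|s - t| <= K * eps) -> s = t.
Proof.
move=> h; apply/eqP; rewrite -subr_eq0 -normr_le0.
apply/ler_addgt0Pr => e e0; rewrite add0r.
have K1 : 0 < `|K| + 1 by rewrite ltr_pwDr.
apply: (le_trans (h (e / (`|K| + 1)) _)); first by rewrite divr_gt0.
rewrite mulrA ler_pdivrMr // [K * _]mulrC ler_wpM2l ?(ltW e0) //.
by rewrite (le_trans (ler_norm K)) // lerDl.
Qed.

(** The closure of the minimal operator is the maximal one. A limit in norm is a limit in each
    coordinate, and a row of the matrix sees at most three of them; conversely the real and
    imaginary parts are approximated separately by [minimal_dense_in_maximal]. *)
Lemma jacobi_operatorP z w :
  J (z, w) <-> [/\ ell2 z, ell2 w & w = jacobi_action a b z].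
Proof.
split.
  move=> [/= hz hw h]; split=> //; apply/jacobi_eqP.
  pose K n := `|if n is m.+1 then a m else 0| + `|b n| + `|a n|.
  have key : forall eps, 0 < eps -> exists z', [/\
      forall n, `|re_seq w n - L (re_seq z') n| <= eps,
      forall n, `|im_seq w n - L (im_seq z') n| <= eps,
      forall n, `|re_seq z n - re_seq z' n| <= eps &
      forall n, `|im_seq z n - im_seq z' n| <= eps].
    move=> eps /h[z' [_ [[/= fz' ->]]]] d1 d2; exists z'.
    have h1 := ell2_coord_le _ (ell2B hz (finitely_supported_ell2 fz')).
    have fJ := finitely_supported_jacobi fz'.
    have h2 := ell2_coord_le _ (ell2B hw (finitely_supported_ell2 fJ)).
    rewrite -re_jacobi -im_jacobi.
    have reB (u v : nat -> R[i]) n : re_seq u n - re_seq v n =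
      re_seq (fun k => u k - v k) n by rewrite /re_seq raddfB.
    have imB (u v : nat -> R[i]) n : im_seq u n - im_seq v n =
      im_seq (fun k => u k - v k) n by rewrite /im_seq raddfB.
    split=> n; rewrite ?reB ?imB.
    - by apply: le_trans (ltW d2); have [] := h2 n.
    - by apply: le_trans (ltW d2); have [] := h2 n.
    - by apply: le_trans (ltW d1); have [] := h1 n.
    - by apply: le_trans (ltW d1); have [] := h1 n.
  (* One [eps] comes from the approximation of [w], and [K n * eps] from row [n] applied to that of
     [z]. *)
  split; apply/funext => n; apply: (@eq_of_close _ _ (1 + K n)) => eps /key
    [z' [h1 h2 h3 h4]].
    have -> : re_seq w n - L (re_seq z) n = (re_seq w n - L (re_seq z') n) -
       L (fun k => re_seq z k - re_seq z' k) n by rewrite tridiagB; ring.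
    rewrite mulrDl mul1r; apply: le_trans (ler_normB _ _) _.
    by apply: lerD => //; exact: tridiag_le.
  have -> : im_seq w n - L (im_seq z) n = (im_seq w n - L (im_seq z') n) -
     L (fun k => im_seq z k - im_seq z' k) n by rewrite tridiagB; ring.
  rewrite mulrDl mul1r; apply: le_trans (ler_normB _ _) _.
  by apply: lerD => //; exact: tridiag_le.
move=> [hz hw wE]; split=> //= eps eps0.
have /ell2P[C [hr hi]] := hz; have /ell2P[D [hLr hLi]] := hw.
have /jacobi_eqP[er ei] := wE; rewrite er in hLr; rewrite ei in hLi.
have d0 : 0 < (eps / 2) ^+ 2 / 2 by rewrite divr_gt0 // exprn_gt0 // divr_gt0.
have [u [[N1 hu] du dLu]] := minimal_dense_in_maximal c_gt0 Lp0 p_div hr hLr d0.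
have [v [[N2 hv] dv dLv]] := minimal_dense_in_maximal c_gt0 Lp0 p_div hi hLi d0.
pose z' n := Complex (u n) (v n).
have half_lt : eps / 2 < eps by rewrite ltr_pdivrMr // ltr_pMr // ltr1n.
have halves : (eps / 2) ^+ 2 / 2 + (eps / 2) ^+ 2 / 2 = (eps / 2) ^+ 2 by field.
exists z', (jacobi_action a b z'); split.
- split=> //; exists (maxn N1 N2) => n; rewrite geq_max => /andP[n1 n2].
  by rewrite /z' hu // hv.
- apply: le_lt_trans half_lt; apply: ell2_norm_le => [|n].
    by rewrite divr_ge0 // ltW.
  rewrite -halves; apply: lerD.
    apply: le_trans (du n); rewrite le_eqVlt; apply/orP; left; apply/eqP.
    by apply: eq_bigr => k _; rewrite /re_seq raddfB.
  apply: le_trans (dv n); rewrite le_eqVlt; apply/orP; left; apply/eqP.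
  by apply: eq_bigr => k _; rewrite /im_seq raddfB.
- apply: le_lt_trans half_lt; apply: ell2_norm_le => [|n].
    by rewrite divr_ge0 // ltW.
  rewrite -halves; apply: lerD.
    apply: le_trans (dLu n); rewrite le_eqVlt; apply/orP; left; apply/eqP.
    apply: eq_bigr => k _; rewrite -er /re_seq raddfB; congr ((_ - _) ^+ 2).
    exact: (congr1 (fun f : nat -> R => f k) (re_jacobi z')).
  apply: le_trans (dLv n); rewrite le_eqVlt; apply/orP; left; apply/eqP.
  apply: eq_bigr => k _; rewrite -ei /im_seq raddfB; congr ((_ - _) ^+ 2).
  exact: (congr1 (fun f : nat -> R => f k) (im_jacobi z')).
Qed.

Lemma real_ip_sym Cx Dx Cy Dy x y :
  sqsum_le Cx x -> sqsum_le Dx (L x) -> sqsum_le Cy y -> sqsum_le Dy (L y) ->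
  real_ip (L x) y = real_ip x (L y).
Proof.
move=> hx hLx hy hLy; apply/eqP; rewrite -subr_eq0; apply/eqP.
have c1 := real_ip_is_cvg hLx hy; have c2 := real_ip_is_cvg hx hLy.
rewrite /real_ip -limB //; apply/cvg_lim => //; apply/cvgr0Pnorm_le => eps eps0.
have [//|M hM] := maximal_symmetric c_gt0 Lp0 p_div hx hLx hy hLy
  (eps := eps ^+ 2); first by rewrite exprn_gt0.
exists M => // n /= Mn.
change (`|\sum_(0 <= k < n) L x k * y k - \sum_(0 <= k < n) x k * L y k| <= eps).
rewrite -(ler_pXn2r (n := 2)) ?nnegrE ?(ltW eps0) // real_normK ?num_real //.
apply: le_trans (hM n Mn); rewrite -sumrB big_mkord.
by under eq_bigr do rewrite [L x _ * _]mulrC.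
Qed.

Lemma real_ip_ge0 C D x : sqsum_le C x -> sqsum_le D (L x) ->
  0 <= real_ip (L x) x.
Proof.
move=> hx hLx; have c1 := real_ip_is_cvg hLx hx.
rewrite leNgt; apply/negP => lim_lt0.
(* Half the distance to 0: partial sums this close to the limit are all below [- eps], against
   [energy_frequently_ge0]. *)
pose eps := - real_ip (L x) x / 2.
have eps0 : 0 < eps by rewrite divr_gt0 // oppr_gt0.
have /cvgrPdist_lt/(_ eps eps0)[M _ hM] := c1.
have [n Mn] := energy_frequently_ge0 c_gt0 Lp0 p_div M hx eps0.
have := hM n Mn.
change (`|real_ip (L x) x - \sum_(0 <= k < n) L x k * x k| < eps -> 
  - eps <= \sum_(k < n) x k * L x k -> False).
rewrite big_mkord; under eq_bigr do rewrite mulrC.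
rewrite ltr_distl /eps; move: (\sum_(k < n) _) (real_ip _ _) => s t /andP[].
lra.
Qed.

End JacobiOperator.

(** * Adjoint, kernel and inverse of the Jacobi operator *)

Section SelfAdjointness.
Variable R : realType.
Variables a b p : nat -> R.
Local Open Scope complex_scope.
Local Open Scope classical_set_scope.
Local Notation L := (tridiag a b).
Local Notation J := (jacobi_operator a b).
Hypothesis c_gt0 : forall n, 0 < flux_coef a p n.
Hypothesis Lp0 : forall n, L p n = 0.
Hypothesis p_div : forall C, ~ sqsum_le C p.
Implicit Types (z w : nat -> R[i]) (x y : nat -> R) (C D eps : R).

Let JP z w := jacobi_operatorP c_gt0 Lp0 p_div z w.

Lemma jacobi_is_operator : is_operator J.
Proof.
split.
- by move=> z w /JP[].
- apply/JP; split; [exact: ell2_0|exact: ell2_0|].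
  by apply/funext => n; rewrite /jacobi_action big1 // => k _; rewrite mulr0.
- move=> c z w z' w' /JP[h1 h2 e1] /JP[h3 h4 e2]; apply/JP.
  by split; [exact: ell2D|exact: ell2D|rewrite e1 e2 jacobi_actionD].
- by move=> z w w' /JP[_ _ ->] /JP[_ _ ->].
Qed.

Lemma jacobi_bounds z w : J (z, w) -> exists C, [/\
  re_seq w = L (re_seq z) /\ im_seq w = L (im_seq z),
  sqsum_le C (re_seq z) /\ sqsum_le C (im_seq z) &
  sqsum_le C (L (re_seq z)) /\ sqsum_le C (L (im_seq z))].
Proof.
move=> /JP[/ell2P[C [h1 h2]] /ell2P[D [h3 h4]]].
move=> /jacobi_eqP[e1 e2]; rewrite e1 in h3; rewrite e2 in h4.
have C0 := sqsum_le_ge0 h1; have D0 := sqsum_le_ge0 h3.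
exists (C + D); split=> //; split.
- by apply: sqsum_leW h1; rewrite lerDl.
- by apply: sqsum_leW h2; rewrite lerDl.
- by apply: sqsum_leW h3; rewrite lerDr.
- by apply: sqsum_leW h4; rewrite lerDr.
Qed.

Lemma jacobi_symmetric z w z' w' : J (z, w) -> J (z', w') ->
  inner w z' = inner z w'.
Proof.
move=> h h'; have [hz hw _] := (JP _ _).1 h; have [hz' hw' _] := (JP _ _).1 h'.
have [C [[e1 e2] [h1 h2] [h3 h4]]] := jacobi_bounds h.
have [D [[d1 d2] [k1 k2] [k3 k4]]] := jacobi_bounds h'.
rewrite !innerE // e1 e2 d1 d2.
rewrite (real_ip_sym c_gt0 Lp0 p_div h1 h3 k1 k3).
rewrite (real_ip_sym c_gt0 Lp0 p_div h2 h4 k2 k4).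
rewrite (real_ip_sym c_gt0 Lp0 p_div h2 h4 k1 k3).
by rewrite (real_ip_sym c_gt0 Lp0 p_div h1 h3 k2 k4).
Qed.

Lemma jacobi_positive_semidefinite : positive_semidefinite J.
Proof.
move=> z w h; have [hz hw _] := (JP _ _).1 h.
have [C [[e1 e2] [h1 h2] [h3 h4]]] := jacobi_bounds h.
rewrite innerE // lecE /= e1 e2 addr_ge0 ?andbT.
- rewrite subr_eq0 [X in _ == X]real_ipC.
  by rewrite (real_ip_sym c_gt0 Lp0 p_div h2 h4 h1 h3).
- exact: (real_ip_ge0 c_gt0 Lp0 p_div h1 h3).
- exact: (real_ip_ge0 c_gt0 Lp0 p_div h2 h4).
Qed.

Definition delta (n m : nat) : R := (m == n)%:R.

Lemma re_basis_vec n : re_seq (basis_vec R n) = delta n.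
Proof. by apply/funext => m; rewrite /re_seq /basis_vec /delta; case: eqP. Qed.

Lemma im_basis_vec n : im_seq (basis_vec R n) = (fun=> 0).
Proof. by apply/funext => m; rewrite /im_seq /basis_vec; case: eqP. Qed.

Lemma finitely_supported_basis_vec n : finitely_supported (basis_vec R n).
Proof. by exists n.+1 => m nm; rewrite /basis_vec gtn_eqF. Qed.

Lemma sum_delta n m x : (n < m)%N -> \sum_(k < m) delta n k * x k = x n.
Proof.
move=> nm; rewrite (bigD1 (Ordinal nm)) //= big1 ?addr0 => [|i].
  by rewrite /delta eqxx mul1r.
by rewrite -val_eqE /= /delta => /negbTE ->; rewrite mul0r.
Qed.

Lemma real_ip_delta n x : real_ip (delta n) x = x n.
Proof. by apply: (@real_ip_eventually _ _ _ _ n.+1) => m; exact: sum_delta. Qed.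

Lemma real_ip0 x : real_ip (fun=> 0) x = 0.
Proof.
by apply: (@real_ip_eventually _ _ _ _ 0) => m _; rewrite big1 // => k _; rewrite mul0r.
Qed.

Lemma tridiag0 : L (fun=> 0) = (fun=> 0).
Proof. by apply/funext => -[|n]; rewrite /tridiag; ring. Qed.

(** Green's identity beyond the support of [delta n] has no boundary term, so [x] may be
    arbitrary. *)
Lemma real_ip_tridiag_delta n x : real_ip (L (delta n)) x = L x n.
Proof.
apply: (@real_ip_eventually _ _ _ _ n.+2) => -[//|m] nm.
have := green_identity a b (delta n) x m.
have -> : delta n m.+1 = 0 by rewrite /delta gtn_eqF // ltnW.
have -> : delta n m = 0 by rewrite /delta gtn_eqF.
rewrite !mulr0 subrr mulr0 sumrB sum_delta; last exact: ltnW.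
by move/eqP; rewrite subr_eq0 => /eqP <-; apply: eq_bigr => k _; rewrite mulrC.
Qed.

Lemma jacobi_basis_vec n : J (basis_vec R n, jacobi_action a b (basis_vec R n)).
Proof.
have h := finitely_supported_basis_vec n.
apply/JP; split=> //; apply: finitely_supported_ell2 => //.
exact: finitely_supported_jacobi.
Qed.

(** Symmetry puts [J] inside its adjoint. Conversely, testing the adjoint relation on basis vectors
    yields [w = jacobi_action a b z], and the maximal operator is [J]. *)
Lemma jacobi_self_adjoint : self_adjoint J.
Proof.
split; first exact: jacobi_is_operator.
  move=> z hz eps eps0; have [z' fz' h] := ell2_truncation hz eps0.
  exists z', (jacobi_action a b z'); split=> //.
  apply/JP; split=> //; apply: finitely_supported_ell2 => //.
  exact: finitely_supported_jacobi.
apply/seteqP; split=> -[z w]; last first.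
  move=> h; have [hz hw _] := (JP _ _).1 h; split=> // z' w' h'.
  exact: jacobi_symmetric h' h.
move=> [/= hz hw h]; apply/JP; split=> //; apply/jacobi_eqP.
(* The minus signs come from conjugation in the second argument of [inner]. *)
have key n : L (re_seq z) n = re_seq w n /\ - L (im_seq z) n = - im_seq w n.
  have Jn := jacobi_basis_vec n; have [h1 h2 _] := (JP _ _).1 Jn.
  have := h _ _ Jn; rewrite !innerE // re_jacobi im_jacobi re_basis_vec im_basis_vec.
  rewrite tridiag0 !real_ip0 !real_ip_tridiag_delta !real_ip_delta.
  by rewrite !addr0 !add0r => -[].
split; apply/funext => n; have [e1 e2] := key n => //.
exact/esym/oppr_inj.
Qed.

Lemma jacobi_kernel z : J (z, fun=> 0) -> z = (fun=> 0).
Proof.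
move=> h; have [C [[e1 e2] [h1 h2] _]] := jacobi_bounds h.
apply/funext => n; apply/eqP; rewrite eq_complex; apply/andP; split; apply/eqP.
  apply: (kernel_trivial c_gt0 Lp0 p_div _ h1) => k.
  by rewrite -e1 /re_seq.
apply: (kernel_trivial c_gt0 Lp0 p_div _ h2) => k.
by rewrite -e2 /im_seq.
Qed.

Lemma jacobi_not_eigenvalue0 : ~ op_eigenvalue J 0.
Proof.
move=> [z [z0]]; under eq_fun do rewrite mul0r.
by move/jacobi_kernel.
Qed.

Lemma jacobi_injective z z' w : J (z, w) -> J (z', w) -> z = z'.
Proof.
move=> h h'; have [_ _ lin _] := jacobi_is_operator.
have := lin (-1) _ _ _ _ h' h.
have -> : (fun n => -1 * w n + w n) = (fun=> 0).
  by apply/funext => n; rewrite mulN1r addNr.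
move/jacobi_kernel => e; apply/funext => n.
have := congr1 (fun f : nat -> R[i] => f n) e => /= /eqP.
by rewrite mulN1r addrC subr_eq0 => /eqP.
Qed.

Lemma jacobi_inv_is_operator : is_operator (op_inv J).
Proof.
have [h1 h2 h3 h4] := jacobi_is_operator.
split=> //=.
- by move=> z w /h1[].
- by move=> c z w z' w'; exact: h3.
- by move=> z w w'; exact: jacobi_injective.
Qed.

(** Exchanging the two components of a graph commutes with taking the adjoint. *)
Lemma jacobi_inv_adjoint : op_adjoint (op_inv J) = op_inv J.
Proof.
have [_ _ h] := jacobi_self_adjoint.
apply/seteqP; split=> -[z w].
  move=> [/= hz hw hJ]; rewrite /op_inv /= -h; split=> // z' w' h'.
  by rewrite -(hJ _ _ h').
rewrite /op_inv /= -{1}h => -[/= hw hz hJ]; split=> // z' w' h'.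
by rewrite (hJ _ _ h').
Qed.

Lemma jacobi_inv_positive_semidefinite : positive_semidefinite (op_inv J).
Proof.
move=> z w h; rewrite -(jacobi_symmetric h h).
exact: jacobi_positive_semidefinite h.
Qed.

End SelfAdjointness.

(** * The inverse and its trace *)

Section Inverse.
Variable R : realType.
Variables a b p : nat -> R.
Local Open Scope complex_scope.
Local Open Scope classical_set_scope.
Local Notation L := (tridiag a b).
Local Notation J := (jacobi_operator a b).
Local Notation c := (flux_coef a p).
Hypothesis c_gt0 : forall n, 0 < c n.
Hypothesis Lp0 : forall n, L p n = 0.
Hypothesis p_div : forall C, ~ sqsum_le C p.
Implicit Types (z w : nat -> R[i]) (x y t : nat -> R) (C D eps T : R).

Let cV_ge0 n : 0 <= (c n)^-1. Proof. by rewrite invr_ge0 ltW. Qed.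

Lemma tail_mono n m k : (m <= k)%N ->
  \sum_(n <= j < m) (c j)^-1 <= \sum_(n <= j < k) (c j)^-1.
Proof.
move=> /subnK <-; elim: (k - m)%N => [//|d IH]; rewrite addSn.
have [nm|nm] := leqP n (d + m); last by rewrite big_geq //; [exact: sumr_ge0|lia].
by rewrite big_nat_recr //= (le_trans IH) // lerDl.
Qed.

(** From index [n] on the flux of [t = y / p] is the constant [p n], so [t m = p n * (tau - S m)].
    Square-summability of [y] forbids [t] to stay away from 0, which forces [S m] to converge to
    [tau = y n / p n ^+ 2]. *)
Lemma inverse_diag C y n : sqsum_le C y -> L y = delta R n ->
  (y n)%:E = ((p n ^+ 2)%:E * \sum_(n <= j <oo) ((c j)^-1)%:E)%E.
Proof.
move=> hy Ly.
pose S m := \sum_(n <= j < m) (c j)^-1.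
pose tau := y n / p n ^+ 2.
have pn0 m : p m != 0 by exact: sol_neq0 c_gt0 m.
pose t m := y m / p m.
have yE : y = (fun m => p m * t m).
  by apply/funext => m; rewrite /t mulrC divfK.
have tE m : (n <= m)%N -> t m = p n * (tau - S m).
  move=> /subnK <-; elim: (m - n)%N => [|d IH].
    by rewrite add0n /S big_geq // subr0 /t /tau; field; exact: pn0.
  rewrite addSn /S big_nat_recr ?leq_addl //= -/(S _).
  have := flux Lp0 t (d + n); rewrite -yE Ly.
  under eq_bigr do rewrite mulrC.
  rewrite sum_delta ?ltnS ?leq_addl // => h.
  have cn0 : c (d + n) != 0 by rewrite gt_eqF.
  have {h} -> : t (d + n).+1 = t (d + n)%N - p n / c (d + n)%N.
    by rewrite h; field.
  by rewrite IH; field.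
have not_away m0 d : 0 < d -> (forall m, (m0 <= m)%N -> d <= (tau - S m) ^+ 2) -> False.
  move=> d0 h; have d0' : 0 < p n ^+ 2 * d.
    by rewrite mulr_gt0 // lt_def sqr_ge0 expf_neq0.
  rewrite yE in hy; apply: (@bounded_away_not_sqsum _ _ p_div C t (maxn n m0) _ d0' _ hy).
  move=> m; rewrite geq_max => /andP[nm m0m].
  by rewrite tE // exprMn ler_wpM2l ?sqr_ge0 ?h.
(* Once above [tau], the nondecreasing [S] would keep its gap. *)
have S_le m : S m <= tau.
  rewrite leNgt; apply/negP => h.
  apply: (not_away m ((S m - tau) ^+ 2)).
    by rewrite exprn_gt0 // subr_gt0.
  move=> k mk; rewrite -[X in _ <= X]sqrrN opprB ler_pXn2r ?nnegrE ?subr_ge0 //.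
  - by rewrite lerD2r tail_mono.
  - exact: ltW.
  - by rewrite (le_trans (ltW h)) // tail_mono.
have -> : (\sum_(n <= j <oo) ((c j)^-1)%:E = tau%:E)%E.
  apply/eqP; rewrite eq_le; apply/andP; split.
    by apply/nneseries_leP.
  (* A limit [sigma] of [S] below [tau] would leave the gap [tau - sigma] at every index. *)
  rewrite leNgt; apply/negP => h.
  have S0 : (0 <= \sum_(n <= j <oo) ((c j)^-1)%:E)%E.
    by apply: nneseries_ge0 => j _ _; rewrite lee_fin.
  have fS : (\sum_(n <= j <oo) ((c j)^-1)%:E)%E \is a fin_num.
    by rewrite ge0_fin_numE // (lt_trans h) ?ltry.
  move: h; rewrite -(fineK fS) lte_fin; set sigma := fine _ => h.
  have hS m : S m <= sigma.
    rewrite -lee_fin /sigma fineK //; move: m; apply/nneseries_leP => //.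
  apply: (not_away 0%N ((tau - sigma) ^+ 2)).
    by rewrite exprn_gt0 // subr_gt0.
  move=> k _; rewrite ler_pXn2r ?nnegrE ?subr_ge0 ?S_le ?(ltW h) //.
  by rewrite lerD2l lerN2.
by rewrite -EFinM /tau mulrC divfK // expf_neq0.
Qed.

(** The solution is [p * t], with [t m] the sum of [F j / c j] over [j >= m]. Cauchy-Schwarz with
    weights [(c j)^-1] bounds [t m ^+ 2] by [W m * (T * C)], and summing against [p m ^+ 2] produces
    the second factor [T]. *)
Lemma real_inverse_exists (W : nat -> R) T C x :
  (forall n m, \sum_(n <= j < m) (c j)^-1 <= W n) ->
  (forall N, \sum_(n < N) p n ^+ 2 * W n <= T) ->
  sqsum_le C x -> exists2 y, L y = x & sqsum_le (T ^+ 2 * C) y.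
Proof.
move=> hW hT hx.
have C0 := sqsum_le_ge0 hx.
have T0 : 0 <= T by have := hT 0%N; rewrite big_ord0.
have W0 n : 0 <= W n by have := hW n n; rewrite big_geq.
pose F j := \sum_(k < j.+1) p k * x k.
pose U j := \sum_(k < j.+1) p k ^+ 2.
have F2 j : F j ^+ 2 <= U j * C.
  apply: le_trans (cauchy_schwarz p x j.+1) _.
  by rewrite ler_wpM2l ?sqsum_ge0.
(* Exchanging the sums over the triangle [n <= j < N] turns [U] into the tails bounded by [W]. *)
have hU N : \sum_(j < N) (c j)^-1 * U j <= T.
  apply: le_trans (hT N).
  have -> : \sum_(j < N) (c j)^-1 * U j =
      \sum_(n < N) p n ^+ 2 * \sum_(n <= j < N) (c j)^-1.
    elim: N => [|N IH]; first by rewrite !big_ord0.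
    rewrite big_ord_recr /= IH [in RHS]big_ord_recr /= big_nat1.
    rewrite /U big_ord_recr /= mulrDr addrA [p N ^+ 2 * _]mulrC; congr (_ + _).
    rewrite mulr_sumr -big_split /=; apply: eq_bigr => n _.
    by rewrite big_nat_recr ?(ltnW (ltn_ord n)) //= mulrDr [_^-1 * _]mulrC.
  by apply: ler_sum => n _; rewrite ler_wpM2l ?sqr_ge0.
have hF N : \sum_(j < N) (c j)^-1 * F j ^+ 2 <= T * C.
  apply: (@le_trans _ _ ((\sum_(j < N) (c j)^-1 * U j) * C)).
    rewrite mulr_suml; apply: ler_sum => j _.
    by rewrite -mulrA ler_wpM2l.
  by rewrite ler_wpM2r.
have tailF m N : (m <= N)%N ->
    (\sum_(m <= j < N) (c j)^-1 * F j) ^+ 2 <= W m * (T * C).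
  move=> mN; have := @cauchy_schwarz_weighted R nat (index_iota m N) predT
    (fun j => (c j)^-1) (fun=> 1) F cV_ge0.
  under eq_bigr do rewrite mulr1; under [X in X * _]eq_bigr do rewrite expr1n mulr1.
  move=> h; apply: le_trans h _; apply: ler_pM => //.
  - exact: sumr_ge0.
  - by apply: sumr_ge0 => j _; rewrite mulr_ge0 ?sqr_ge0.
  - apply: le_trans (hF N); rewrite -(big_mkord predT (fun j => (c j)^-1 * F j ^+ 2)).
    rewrite [X in _ <= X](big_cat_nat (n := m)) //= lerDr.
    by apply: sumr_ge0 => j _; rewrite mulr_ge0 ?sqr_ge0.
have cvg : cvgn (series (fun j => (c j)^-1 * F j)).
  apply: normed_cvg; apply: nondecreasing_is_cvgn.
    apply/nondecreasing_seqP => n.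
    change (\sum_(0 <= k < n) `|(c k)^-1 * F k| <=
      \sum_(0 <= k < n.+1) `|(c k)^-1 * F k|).
    by rewrite big_nat_recr //= lerDl.
  exists (W 0%N + T * C) => _ [n _ <-].
  change (\sum_(0 <= k < n) `|(c k)^-1 * F k| <= W 0%N + T * C).
  apply: le_trans (lerD (hW 0%N n) (hF n)).
  rewrite -(big_mkord predT (fun j => (c j)^-1 * F j ^+ 2)) -big_split /=.
  apply: ler_sum => k _; rewrite normrM ger0_norm //.
  rewrite -[X in _ <= X + _]mulr1 -mulrDr ler_wpM2l //.
  by have := normM_le_sqrD 1 (F k); rewrite mul1r expr1n.
(* Tails are written as total minus head, so that the increments of [t] are immediate. *)
pose t m := limn (series (fun j => (c j)^-1 * F j)) - \sum_(0 <= j < m) (c j)^-1 * F j.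
have t2 m : t m ^+ 2 <= W m * (T * C).
  have ct : (fun N => (\sum_(0 <= j < N) (c j)^-1 * F j -
      \sum_(0 <= j < m) (c j)^-1 * F j) ^+ 2) @ \oo --> t m ^+ 2.
    have c1 : (fun N => \sum_(0 <= j < N) (c j)^-1 * F j -
      \sum_(0 <= j < m) (c j)^-1 * F j) @ \oo --> t m.
      by apply: cvgB; [exact: cvg|exact: cvg_cst].
    under eq_fun do rewrite expr2.
    by rewrite expr2; exact: cvgM.
  rewrite -(cvg_lim _ ct) //; apply: limr_le; first by apply/cvg_ex; exists (t m ^+ 2).
  exists m => // N /= mN.
  rewrite (big_cat_nat (n := m)) //= addrAC subrr add0r; exact: tailF.
exists (fun k => p k * t k).
  apply/funext => n; apply: (flux_solve c_gt0 Lp0) => m.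
  rewrite -/(F m) /t big_nat_recr //=.
  have cm0 : c m != 0 by rewrite gt_eqF.
  by field.
move=> N; apply: (@le_trans _ _ (\sum_(m < N) p m ^+ 2 * W m * (T * C))).
  by apply: ler_sum => m _; rewrite exprMn -mulrA ler_wpM2l ?sqr_ge0.
by rewrite -mulr_suml expr2 -mulrA ler_wpM2r ?mulr_ge0.
Qed.

(** * The trace of the inverse as the sum of the diagonal Green function *)

Let tailW n : \bar R := (\sum_(n <= j <oo) ((c j)^-1)%:E)%E.
Let green_trace : \bar R := (\sum_(n <oo) (p n ^+ 2)%:E * tailW n)%E.

Let tailW_ge0 n : (0 <= tailW n)%E.
Proof. by apply: nneseries_ge0 => j _ _; rewrite lee_fin. Qed.

(** As every [p n ^+ 2] is positive, a finite trace makes all tails finite, and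
    [real_inverse_exists] applies to real and imaginary parts with [T] the trace. *)
Lemma jacobi_inv_bounded : (green_trace < +oo)%E -> bounded_operator (op_inv J).
Proof.
move=> tr_fin.
have term_ge0 n : (0 <= (p n ^+ 2)%:E * tailW n)%E.
  by rewrite mule_ge0 // lee_fin sqr_ge0.
have tr_ge0 : (0 <= green_trace)%E by apply: nneseries_ge0 => n _ _.
have p2_gt0 n : 0 < p n ^+ 2.
  by rewrite lt_def sqr_ge0 expf_neq0 //; exact: sol_neq0 c_gt0 n.
have W_fin n : tailW n \is a fin_num.
  rewrite ge0_fin_numE // ltey; apply/eqP => Woo.
  have : green_trace = +oo%E.
    apply: (@nneseries_pinfty _ _ _ n) => //.
    by rewrite Woo gt0_muley // lte_fin.
  by move=> h; rewrite h ltxx in tr_fin.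
pose W n := fine (tailW n).
pose T := fine green_trace.
have hW n m : \sum_(n <= j < m) (c j)^-1 <= W n.
  rewrite -lee_fin /W fineK //; move: m; exact/nneseries_leP.
have W0 n : 0 <= W n by rewrite fine_ge0.
have hT N : \sum_(n < N) p n ^+ 2 * W n <= T.
  rewrite -lee_fin /T fineK ?ge0_fin_numE // -(big_mkord predT (fun n => p n ^+ 2 * W n)).
  move: N; apply/nneseries_leP => [n|]; first by rewrite mulr_ge0 // sqr_ge0.
  by rewrite le_eqVlt; apply/orP; left; apply/eqP; apply: eq_eseriesr => n _;
    rewrite EFinM /W fineK.
have T0 : 0 <= T by rewrite fine_ge0.
(* The factor 2 has room for the two parts, each contributing at most [T ^+ 2 * ell2_norm w ^+ 2] to
   the squared norm. *)
have ex w : ell2 w -> exists2 z, op_inv J (w, z) & ell2_norm z <= 2 * T * ell2_norm w.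
  move=> hw; have N0 : 0 <= ell2_norm w by exact: sqrtr_ge0.
  have hr : sqsum_le (ell2_norm w ^+ 2) (re_seq w).
    by move=> n; apply: le_trans (ell2_norm_partial n hw); rewrite lerDl sqsum_ge0.
  have hi : sqsum_le (ell2_norm w ^+ 2) (im_seq w).
    by move=> n; apply: le_trans (ell2_norm_partial n hw); rewrite lerDr sqsum_ge0.
  have [u Lu hu] := real_inverse_exists hW hT hr.
  have [v Lv hv] := real_inverse_exists hW hT hi.
  pose z n := Complex (u n) (v n).
  have hz : ell2 z by apply/ell2P; exists (T ^+ 2 * ell2_norm w ^+ 2).
  exists z.
    by apply/(jacobi_operatorP c_gt0 Lp0 p_div); split=> //; apply/jacobi_eqP.
  apply: ell2_norm_le => [|n]; first by rewrite !mulr_ge0.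
  apply: le_trans (lerD (hu n) (hv n)) _.
  have -> : (2 * T * ell2_norm w) ^+ 2 = 4 * (T ^+ 2 * ell2_norm w ^+ 2) by ring.
  rewrite -mulr2n -[X in X <= _]mulr_natl ler_wpM2r ?ler_nat //.
  by rewrite mulr_ge0 ?sqr_ge0.
split; first exact: jacobi_inv_is_operator c_gt0 Lp0 p_div.
  by move=> w /ex[z hz _]; exists z.
exists (2 * T) => w z h.
have [_ hw _] := (jacobi_operatorP c_gt0 Lp0 p_div _ _).1 h.
have [z' h' bound] := ex _ hw.
by rewrite (jacobi_injective c_gt0 Lp0 p_div (h : J (z, w)) h').
Qed.

Lemma jacobi_inv_diag_sum : bounded_operator (op_inv J) ->
  diag_sum (op_inv J) = green_trace.
Proof.
move=> [_ total _]; apply: eq_eseriesr => n _.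
set z := op_apply _ _.
have en := finitely_supported_ell2 (@finitely_supported_basis_vec R n).
have hz : J (z, basis_vec R n).
  (* Boundedness puts every basis vector in the domain, so [op_apply] is not at its default
     value. *)
  by have := xgetPex (fun=> 0) (total _ en).
have [hz2 _ _] := (jacobi_operatorP c_gt0 Lp0 p_div _ _).1 hz.
have [C [[e1 e2] [h1 _] _]] := jacobi_bounds c_gt0 Lp0 p_div hz.
rewrite innerE //= re_basis_vec im_basis_vec real_ipC real_ip_delta.
rewrite [X in _ + X]real_ipC real_ip0 addr0.
by apply: inverse_diag h1 _; rewrite -e1 re_basis_vec.
Qed.

(** Outside the trace class the trace is infinite by convention, and so is [green_trace]: were it
    finite, the inverse would be bounded and, being positive and self-adjoint, would be its own
    absolute value with finite diagonal sum. *)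
Lemma jacobi_inv_trace : op_trace (op_inv J) = green_trace.
Proof.
rewrite /op_trace; case: asboolP => [[bd _]|not_tc]; first exact: jacobi_inv_diag_sum.
apply/eqP; rewrite eq_sym; apply/negPn/negP; rewrite -ltey => tr_fin; apply: not_tc.
have bd := jacobi_inv_bounded tr_fin; split=> //; exists (op_inv J); split=> //.
  split; last by rewrite (jacobi_inv_adjoint c_gt0 Lp0 p_div).
    split; [exact: jacobi_inv_is_operator c_gt0 Lp0 p_div|..
           |exact: jacobi_inv_adjoint c_gt0 Lp0 p_div].
    have [_ total _] := bd.
    move=> z hz eps eps0; have [w hw] := total z hz.
    exists z, w; split=> //; under eq_fun do rewrite subrr.
    by rewrite ell2_norm0.
  exact: jacobi_inv_positive_semidefinite c_gt0 Lp0 p_div.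
by rewrite jacobi_inv_diag_sum.
Qed.

End Inverse.

(** * Birth-death parameters *)

Section BirthDeathSums.
Variable R : realType.
Variables lam mu : nat -> R.
Hypothesis lam_gt0 : forall n, 0 < lam n.
Hypothesis mu_gt0 : forall n, 0 < mu n.+1.
Hypothesis mu0_ge0 : 0 <= mu 0%N.
Local Open Scope classical_set_scope.
Local Notation ppi := (bd_pi lam mu).
Local Notation s := (bd_s lam mu).
Local Notation s_infty := (bd_s_infty lam mu).
Local Notation a := (fun n => Num.sqrt (lam n * mu n.+1)).
Local Notation b := (fun n => lam n + mu n).
Implicit Types n m : nat.

Lemma bd_pi_gt0 n : 0 < ppi n.
Proof. by rewrite divr_gt0 // prodr_gt0. Qed.

(** Detailed balance. *)
Lemma bd_piS n : ppi n.+1 * mu n.+1 = lam n * ppi n.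
Proof.
rewrite /bd_pi !big_ord_recr /=.
have h : \prod_(k < n) mu k.+1 != 0 by rewrite gt_eqF // prodr_gt0.
have hm : mu n.+1 != 0 by rewrite gt_eqF.
by field; rewrite hm h.
Qed.

Lemma bd_sS n : s n.+1 = s n + mu 0%N * (lam n * ppi n)^-1.
Proof. by rewrite /bd_s big_ord_recr /= mulrDr. Qed.

Let rho_gt0 n : 0 < (lam n * ppi n)^-1.
Proof. by rewrite invr_gt0 mulr_gt0 // bd_pi_gt0. Qed.

Lemma bd_s_nondecreasing : nondecreasing_seq s.
Proof.
apply/nondecreasing_seqP => n.
by rewrite bd_sS lerDl mulr_ge0 // ltW.
Qed.

Lemma bd_s_ge0 n : 0 <= s n.
Proof. by rewrite mulr_ge0 // sumr_ge0 // => k _; rewrite ltW. Qed.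

Lemma onep_s_gt0 n : 0 < 1 + s n.
Proof. by rewrite ltr_pwDl // bd_s_ge0. Qed.

(** The alternating sign makes the flux coefficients positive although the off-diagonal entries
    are. *)
Definition bd_sol n : R := (-1) ^+ n * (Num.sqrt (ppi n) * (1 + s n)).

(** Detailed balance under square roots; with [sqrt_pi_down] it reduces the equation for [bd_sol] to
    a rational identity. *)
Lemma sqrt_pi_up n : a n * Num.sqrt (ppi n.+1) = lam n * Num.sqrt (ppi n).
Proof.
have l0 := ltW (lam_gt0 n).
rewrite -sqrtrM ?mulr_ge0 ?ltW //.
have -> : lam n * mu n.+1 * ppi n.+1 = lam n ^+ 2 * ppi n.
  by rewrite expr2 -[RHS]mulrA -bd_piS; ring.
by rewrite sqrtrM ?sqr_ge0 // sqrtr_sqr ger0_norm.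
Qed.

Lemma sqrt_pi_down n : a n * Num.sqrt (ppi n) = mu n.+1 * Num.sqrt (ppi n.+1).
Proof.
have l0 := ltW (lam_gt0 n); have m0 := ltW (mu_gt0 n).
rewrite -sqrtrM ?mulr_ge0 //.
have -> : lam n * mu n.+1 * ppi n = mu n.+1 ^+ 2 * ppi n.+1.
  by rewrite mulrAC -bd_piS; ring.
by rewrite sqrtrM ?sqr_ge0 // sqrtr_sqr ger0_norm.
Qed.

(** Behind the computation, [lam n * ppi n * (s n.+1 - s n)] always equals [mu 0], so [1 + s] is
    harmonic for the birth-death generator. *)
Lemma bd_sol_tridiag n : tridiag a b bd_sol n = 0.
Proof.
case: n => [|n].
  rewrite /tridiag /bd_sol expr0 expr1 add0r.
  have -> : a 0%N * (-1 * (Num.sqrt (ppi 1) * (1 + s 1))) =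
    - (a 0%N * Num.sqrt (ppi 1)) * (1 + s 1) by ring.
  rewrite sqrt_pi_up bd_sS.
  have -> : s 0 = 0 by rewrite /bd_s big_ord0 mulr0.
  have -> : ppi 0 = 1 by rewrite /bd_pi !big_ord0 divr1.
  by rewrite sqrtr1; field; rewrite gt_eqF.
rewrite /tridiag /bd_sol !exprS.
have -> : a n * ((-1) ^+ n * (Num.sqrt (ppi n) * (1 + s n))) =
  (-1) ^+ n * (a n * Num.sqrt (ppi n)) * (1 + s n) by ring.
have -> : a n.+1 * (-1 * (-1 * (-1) ^+ n) * (Num.sqrt (ppi n.+2) * (1 + s n.+2))) =
  (-1) ^+ n * (a n.+1 * Num.sqrt (ppi n.+2)) * (1 + s n.+2) by ring.
rewrite sqrt_pi_up sqrt_pi_down !bd_sS.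
have l0 : lam n != 0 by rewrite gt_eqF.
have l1 : lam n.+1 != 0 by rewrite gt_eqF.
have p0 : ppi n != 0 by rewrite gt_eqF // bd_pi_gt0.
have m1 : mu n.+1 != 0 by rewrite gt_eqF.
have -> : ppi n.+1 = lam n * ppi n / mu n.+1 by rewrite -bd_piS mulfK.
by field; rewrite l0 l1 p0 m1.
Qed.

Lemma bd_sol_flux n : flux_coef a bd_sol n =
  lam n * ppi n * (1 + s n) * (1 + s n.+1).
Proof.
rewrite /flux_coef /bd_sol exprS.
have -> : - (a n * ((-1) ^+ n * (Num.sqrt (ppi n) * (1 + s n))) *
   (-1 * (-1) ^+ n * (Num.sqrt (ppi n.+1) * (1 + s n.+1)))) =
   ((-1) ^+ n) ^+ 2 * (a n * Num.sqrt (ppi n.+1)) * Num.sqrt (ppi n) *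
   (1 + s n) * (1 + s n.+1) by ring.
rewrite sqrr_sign mul1r sqrt_pi_up -[X in lam n * X * _]sqr_sqrtr; first by ring.
exact: ltW (bd_pi_gt0 n).
Qed.

Lemma bd_sol_flux_gt0 n : 0 < flux_coef a bd_sol n.
Proof.
rewrite bd_sol_flux mulr_gt0 ?onep_s_gt0 // mulr_gt0 ?onep_s_gt0 //.
by rewrite mulr_gt0 // bd_pi_gt0.
Qed.

Lemma bd_sol_sqr n : bd_sol n ^+ 2 = ppi n * (1 + s n) ^+ 2.
Proof.
by rewrite /bd_sol exprMn sqrr_sign mul1r exprMn sqr_sqrtr // ltW // bd_pi_gt0.
Qed.

Lemma bd_sol_div : (\sum_(n <oo) (ppi n * (1 + s n) ^+ 2)%:E = +oo)%E ->
  forall C, ~ sqsum_le C bd_sol.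
Proof.
move=> div C hC.
have : (\sum_(n <oo) (ppi n * (1 + s n) ^+ 2)%:E <= C%:E)%E.
  apply/nneseries_leP => [n|n].
    by rewrite mulr_ge0 ?sqr_ge0 // ltW // bd_pi_gt0.
  rewrite lee_fin big_mkord; apply: le_trans (hC n).
  by apply: ler_sum => k _; rewrite bd_sol_sqr.
by rewrite div leye_eq.
Qed.

Let w n := (lam n * ppi n * (1 + s n) * (1 + s n.+1))^-1.

Let w_ge0 n : 0 <= w n.
Proof. by rewrite /w -bd_sol_flux invr_ge0 ltW // bd_sol_flux_gt0. Qed.

Lemma bd_s_tail n m : (n <= m)%N ->
  s m = s n + mu 0%N * \sum_(n <= j < m) (lam j * ppi j)^-1.
Proof.
move=> /subnK <-; elim: (m - n)%N => [|d IH].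
  by rewrite add0n big_geq // mulr0 addr0.
by rewrite addSn bd_sS IH big_nat_recr ?leq_addl //= mulrDr addrA.
Qed.

(** Multiplied by [mu 0], this is the telescoping of [(1 + s j)^-1]. The form chosen and the
    induction also cover [mu 0 = 0]. *)
Lemma tail_partial n m : (n <= m)%N -> \sum_(n <= j < m) w j =
  (\sum_(n <= j < m) (lam j * ppi j)^-1) * ((1 + s n)^-1 * (1 + s m)^-1).
Proof.
move=> /subnK <-; elim: (m - n)%N => [|d IH].
  by rewrite add0n !big_geq // mul0r.
rewrite addSn !(@big_nat_recr _ _ _ (d + n)) ?leq_addl //= IH.
have := @bd_s_tail n (d + n) (leq_addl _ _).
have := bd_sS (d + n).
have := onep_s_gt0 n; have := onep_s_gt0 (d + n); have := onep_s_gt0 (d + n).+1.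
have -> : w (d + n) = (lam (d + n) * ppi (d + n))^-1 * (1 + s (d + n))^-1 *
  (1 + s (d + n).+1)^-1 by rewrite /w -!invfM.
move: (rho_gt0 (d + n)).
set r := (lam _ * _)^-1; set Q := \sum_(n <= j < d + n) _.
move: (s n) (s (d + n)%N) (s (d + n).+1) => x y z r0 /gt_eqF/negbT z0.
move=> /gt_eqF/negbT y0 /gt_eqF/negbT x0 ez ey; subst.
by field; rewrite x0 y0 z0.
Qed.

Let rho_tail n : \bar R := (\sum_(n <= j <oo) ((lam j * ppi j)^-1)%:E)%E.

Lemma bd_s_cvg : (fun n => (s n)%:E) @ \oo --> s_infty.
Proof.
have nd : nondecreasing_seq (fun n => (s n)%:E).
  by move=> n m nm; rewrite lee_fin bd_s_nondecreasing.
by rewrite /bd_s_infty (cvg_lim _ (ereal_nondecreasing_cvgn nd)) //;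
  exact: ereal_nondecreasing_cvgn.
Qed.

Lemma bd_s_infty_ge0 : (0 <= s_infty)%E.
Proof.
apply: lime_ge; first by apply/cvg_ex; exists s_infty; exact: bd_s_cvg.
by apply: nearW => n; rewrite lee_fin bd_s_ge0.
Qed.


Lemma eseries_cvg_eq (f g : nat -> R) n (l : \bar R) :
  (forall m, (n <= m)%N -> \sum_(n <= j < m) f j = g m) ->
  (fun m => (g m)%:E) @ \oo --> l ->
  (\sum_(n <= j <oo) (f j)%:E = l)%E.
Proof.
move=> fg gl; apply/cvg_lim => //; apply: cvg_trans gl.
apply: near_eq_cvg; exists n => // m /= nm.
by rewrite sumEFin fg.
Qed.

Lemma tail_sum_fin (sigma : R) n : s_infty = sigma%:E ->
  (\sum_(n <= j <oo) (w j)%:E = ((1 + sigma)^-1 / (1 + s n))%:E * rho_tail n)%E.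
Proof.
move=> sE.
have s1 : 0 < 1 + sigma.
  by rewrite ltr_pwDl // -lee_fin -sE bd_s_infty_ge0.
have cs : s @ \oo --> sigma.
  by have := bd_s_cvg; rewrite sE => /fine_cvgP[].
have c2 : (fun m => (((1 + s n)^-1 * (1 + s m)^-1))%:E) @ \oo -->
    ((1 + s n)^-1 * (1 + sigma)^-1)%:E.
  apply: cvg_EFin; first by apply: nearW.
  apply: cvgMr; apply: cvgV; first by rewrite gt_eqF.
  by apply: cvgD => //; exact: cvg_cst.
have c1 : (fun m => (\sum_(n <= j < m) (lam j * ppi j)^-1)%:E) @ \oo --> rho_tail n.
  have /cvg_ex[l hl] : cvgn (fun m => \sum_(n <= j < m) ((lam j * ppi j)^-1)%:E)%E.
    by apply: is_cvg_nneseries => j _ _; rewrite lee_fin ltW.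
  rewrite /rho_tail (cvg_lim _ hl) //.
  by under eq_fun do rewrite -sumEFin.
have inv_gt0 : 0 < (1 + s n)^-1 * (1 + sigma)^-1.
  by rewrite mulr_gt0 // invr_gt0 ?onep_s_gt0.
(* The tail may be infinite, but its factor is positive, so no product of 0 and infinity arises in
   the limit. *)
have def : (rho_tail n *? ((1 + s n)^-1 * (1 + sigma)^-1)%:E)%E.
  by rewrite /mule_def; case: (rho_tail n) => //=; rewrite gt_eqF.
rewrite [X in (X%:E * _)%E]mulrC muleC.
apply: (@eseries_cvg_eq w (fun m =>
  (\sum_(n <= j < m) (lam j * ppi j)^-1) * ((1 + s n)^-1 * (1 + s m)^-1))).
  exact: tail_partial.
under eq_fun do rewrite EFinM.
exact: cvgeM def c1 c2.
Qed.

(** Divergence of [s] forces [mu 0] to be nonzero; dividing by it turns [tail_partial] into a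
    difference whose second term tends to 0. *)
Lemma tail_sum_pinfty n : s_infty = +oo%E ->
  (\sum_(n <= j <oo) (w j)%:E = ((mu 0%N * (1 + s n))^-1)%:E)%E.
Proof.
move=> sE.
have cs : s @ \oo --> +oo by have := bd_s_cvg; rewrite sE => /cvgeryP.
have mu0_neq0 : mu 0%N != 0.
  apply/eqP => m0.
  have s0 m : s m = 0 by rewrite /bd_s m0 mul0r.
  have : s_infty = 0%:E.
    by rewrite /bd_s_infty; under eq_fun do rewrite s0; exact: lim_cst.
  by rewrite sE.
have cinv : (fun m => (1 + s m)^-1) @ \oo --> (0 : R).
  apply/gtr0_cvgV0; first by apply: nearW => m; exact: onep_s_gt0.
  apply/cvgryPge => A; near=> m; apply: (@le_trans _ _ (s m)); last by rewrite lerDr.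
  by near: m; exact: (cvgryPge _).1.
apply: (@eseries_cvg_eq w (fun m => (mu 0%N)^-1 * ((1 + s n)^-1 - (1 + s m)^-1))).
  move=> m nm; rewrite tail_partial //.
  have := bd_s_tail nm; have := onep_s_gt0 n; have := onep_s_gt0 m.
  set Q := \sum_(n <= j < m) _; move: (s n) (s m) => x y.
  move=> /gt_eqF/negbT y0 /gt_eqF/negbT x0 ey; subst.
  by field; rewrite mu0_neq0 x0 y0.
apply: cvg_EFin; first by apply: nearW.
have -> : (mu 0%N * (1 + s n))^-1 = (mu 0%N)^-1 * ((1 + s n)^-1 - 0).
  by rewrite subr0 invfM.
apply: cvgMr.
by apply: cvgB => //; exact: cvg_cst.
Unshelve. all: by end_near. Qed.

Let P n := ppi n * (1 + s n).

Let P_ge0 n : 0 <= P n.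
Proof. by rewrite mulr_ge0 // ltW ?bd_pi_gt0 ?onep_s_gt0. Qed.

Lemma green_trace_fin (sigma : R) : s_infty = sigma%:E ->
  (\sum_(n <oo) (bd_sol n ^+ 2)%:E * \sum_(n <= j <oo) (w j)%:E =
   ((1 + sigma)^-1)%:E * \sum_(n <oo) (P n)%:E * rho_tail n)%E.
Proof.
move=> sE.
rewrite -nneseriesZl; last first.
  move=> n _; rewrite mule_ge0 ?lee_fin //.
  by apply: nneseries_ge0 => j _ _; rewrite lee_fin ltW.
apply: eq_eseriesr => n _; rewrite (tail_sum_fin n sE) !muleA -!EFinM.
congr (_%:E * _)%E; rewrite bd_sol_sqr /P mulrA [RHS]mulrC.
have := onep_s_gt0 n; move: (s n) (1 + sigma)^-1 => x v /gt_eqF/negbT x0.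
by field.
Qed.

Lemma green_trace_pinfty : s_infty = +oo%E ->
  (\sum_(n <oo) (bd_sol n ^+ 2)%:E * \sum_(n <= j <oo) (w j)%:E =
   ((mu 0%N)^-1)%:E * \sum_(n <oo) (P n)%:E)%E.
Proof.
move=> sE.
rewrite -nneseriesZl; last by move=> n _; rewrite lee_fin.
apply: eq_eseriesr => n _; rewrite (tail_sum_pinfty n sE) -!EFinM.
congr (_%:E); rewrite bd_sol_sqr /P invfM.
have := onep_s_gt0 n; move: (s n) (mu 0%N)^-1 => x v /gt_eqF/negbT x0.
by field.
Qed.

(** Tonelli's theorem for the nonnegative array [f], extended by 0 outside the triangle [n <= j]. *)
Lemma green_trace_interchange :
  (\sum_(n <oo) (P n)%:E * rho_tail n =
   \sum_(j <oo) ((lam j * ppi j)^-1)%:E * \sum_(n < j.+1) (P n)%:E)%E.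
Proof.
pose f n j : \bar R := if (n <= j)%N then (P n * (lam j * ppi j)^-1)%:E else 0%E.
have f_ge0 n j : (0 <= f n j)%E.
  by rewrite /f; case: ifP => // _; rewrite lee_fin mulr_ge0 // ltW.
transitivity (\sum_(n <oo) \sum_(j <oo) f n j)%E.
  apply: eq_eseriesr => n _; rewrite /rho_tail eseries_cond -nneseriesZl; last first.
    by move=> j _; rewrite lee_fin ltW.
  by rewrite eseries_mkcond; apply: eq_eseriesr => j _; rewrite /f EFinM.
rewrite nneseries_interchange //; apply: eq_eseriesr => j _.
rewrite (nneseries_split 0 j.+1) // add0n eseries0 ?adde0; last first.
  by move=> n jn _; rewrite /f leqNgt jn.
rewrite big_mkord ge0_sume_distrr; last by move=> n _; rewrite lee_fin.
apply: eq_bigr => n _; rewrite /f -ltnS ltn_ord -EFinM mulrC //.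
Qed.

End BirthDeathSums.

Unset Implicit Arguments.
Local Open Scope ereal_scope.

Theorem theorem3p3 (R : realType) (lam mu : nat -> R)
  (lam_gt0 : forall n : nat, (0 < lam n)%R)
  (mu_gt0 : forall n : nat, (0 < mu n.+1)%R)
  (mu0_ge0 : (0 <= mu 0%N)%R)
  (hdiv : \sum_(n <oo) (bd_pi lam mu n * (1 + bd_s lam mu n) ^+ 2)%:E = +oo) :
  let pi := bd_pi lam mu in
  let s := bd_s lam mu in
  let s_infty := bd_s_infty lam mu in
  let J := bd_jacobi lam mu in
  [/\ self_adjoint J /\ positive_semidefinite J,
      ~ op_eigenvalue J 0%R,
      s_infty < +oo ->
        op_trace (op_inv J) =
          (1 + s_infty)^-1 *
            \sum_(n <oo) ((pi n * (1 + s n))%:E *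
              \sum_(n <= j <oo) ((lam j * pi j)^-1)%:E)
        /\
        (1 + s_infty)^-1 *
            \sum_(n <oo) ((pi n * (1 + s n))%:E *
              \sum_(n <= j <oo) ((lam j * pi j)^-1)%:E) =
          (1 + s_infty)^-1 *
            \sum_(j <oo) (((lam j * pi j)^-1)%:E *
              \sum_(n < j.+1) (pi n * (1 + s n))%:E) &
      s_infty = +oo ->
        op_trace (op_inv J) =
          ((mu 0%N)^-1)%:E * \sum_(n <oo) (pi n * (1 + s n))%:E].
Proof.
move=> pi s s_infty J.
have c_gt0 := bd_sol_flux_gt0 lam_gt0 mu_gt0 mu0_ge0.
have Lp0 := bd_sol_tridiag lam_gt0 mu_gt0.
have p_div := bd_sol_div lam_gt0 mu_gt0 hdiv.
have traceE : op_trace (op_inv J) = \sum_(n <oo) (bd_sol lam mu n ^+ 2)%:E *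
    \sum_(n <= j <oo) ((lam j * pi j * (1 + s j) * (1 + s j.+1))^-1)%:E.
  rewrite (jacobi_inv_trace c_gt0 Lp0 p_div).
  apply: eq_eseriesr => n _; congr (_ * _); apply: eq_eseriesr => j _.
  by rewrite (bd_sol_flux lam_gt0 mu_gt0).
split.
- split; first exact: jacobi_self_adjoint c_gt0 Lp0 p_div.
  exact: jacobi_positive_semidefinite c_gt0 Lp0 p_div.
- exact: jacobi_not_eigenvalue0 c_gt0 Lp0 p_div.
- move=> s_fin.
  have s_ge0 : 0 <= s_infty by exact: bd_s_infty_ge0.
  have sE : s_infty = (fine s_infty)%:E by rewrite fineK // ge0_fin_numE.
  (* The extended-real inverse is the real one, since [1 + s_infty] is finite and positive. *)
  have -> : (1 + s_infty)^-1 = ((1 + fine s_infty)^-1)%:E.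
    by rewrite sE -EFinD inver gt_eqF // ltr_pwDl // fine_ge0.
  split; first by rewrite traceE (green_trace_fin lam_gt0 mu_gt0 mu0_ge0 sE).
  by rewrite (green_trace_interchange lam_gt0 mu_gt0 mu0_ge0).
- by move=> sE; rewrite traceE (green_trace_pinfty lam_gt0 mu_gt0 mu0_ge0 sE).
Qed.
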